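(* For every topological graph $X$ we have $h(Homeo(X),X)<+\infty$ and $P_h(X)=\{h(Homeo(X),X),\,h(Homeo(X),X)+1,\,h(Homeo(X),X)+2,\ldots\}\cup\{+\infty\}$.
   Context: A topological graph is a compact connected metric space which is a finite union of arcs (spaces homeomorphic to $[0,1]$; the points corresponding to $0,1$ are the end points) such that any two of these arcs intersect in at most their end points. For a topological space $A$, $Homeo(A)$ denotes the group of all homeomorphisms $A\to A$ under composition. For a subgroup $G$ of $Homeo(A)$ (acting by $gx=g(x)$), a nonempty subset $Y\subseteq A$ is invariant if $g(y)\in Y$ for all $g\in G$, $y\in Y$. The height of $(G,A)$ is $h(G,A)=\sup\{n\geq 0:$ there exist distinct closed invariant subsets $Y_0\subset Y_1\subset\cdots\subset Y_n=A\}$ (possibly $+\infty$). Finally $P_h(A)=\{h(G,A): G \text{ is a subgroup of } Homeo(A)\}$. *)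

(* Defs.v *)
From HB Require Import structures.
From mathcomp Require Import all_boot all_order all_algebra.
From mathcomp Require Import all_classical all_reals all_analysis.
Import numFieldNormedType.Exports.
Set Implicit Arguments. Unset Strict Implicit. Unset Printing Implicit Defensive.
Import Order.TTheory GRing.Theory Num.Theory.
Local Open Scope classical_set_scope.
Local Open Scope ring_scope.

Definition is_arc (R : realType) (X : topologicalType) (A : set X) (a b : X) : Prop :=
  exists (f : R -> X) (g : X -> R),
    {within `[0%R, 1%R]%classic, continuous f} /\
    f @` `[0%R, 1%R]%classic = A /\
    {within A, continuous (g : X -> R)} /\
    g @` A `<=` `[0%R, 1%R]%classic /\
    (forall t, `[0%R, 1%R]%classic t -> g (f t) = t) /\
    (forall x, A x -> f (g x) = x) /\
    f 0 = a /\ f 1 = b.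

(* A topological graph: a compact connected metric space (pseudometric +
   Hausdorff) which is a finite (nonempty) union of arcs, any two of which
   intersect in at most their end points. *)
Definition topological_graph (R : realType) (X : pseudoMetricType R) : Prop :=
  hausdorff_space X /\ compact [set: X] /\ connected [set: X] /\
  exists (n : nat) (A : nat -> set X) (a b : nat -> X),
    (0 < n)%N /\
    (forall i, (i < n)%N -> is_arc R (A i) (a i) (b i)) /\
    \bigcup_(i in [set i | (i < n)%N]) A i = [set: X] /\
    (forall i j, (i < n)%N -> (j < n)%N -> i <> j ->
       A i `&` A j `<=` [set a i; b i] `&` [set a j; b j]).

Definition is_homeo (X : topologicalType) (f : X -> X) : Prop :=
  continuous f /\ exists g : X -> X, continuous g /\ cancel f g /\ cancel g f.

Arguments is_homeo : clear implicits.
Definition Homeo (X : topologicalType) : set (X -> X) := [set f | is_homeo X f].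
Arguments Homeo : clear implicits.

Definition subgroup_Homeo (X : topologicalType) (G : set (X -> X)) : Prop :=
  G `<=` Homeo X /\ G id /\
  (forall f g, G f -> G g -> G (f \o g)) /\
  (forall f, G f -> exists g, G g /\ cancel f g /\ cancel g f).

Definition G_invariant (X : topologicalType) (G : set (X -> X)) (Y : set X) : Prop :=
  Y !=set0 /\ forall g y, G g -> Y y -> Y (g y).

Definition has_chain (X : topologicalType) (G : set (X -> X)) (n : nat) : Prop :=
  exists Y : nat -> set X,
    (forall i, (i <= n)%N -> closed (Y i) /\ G_invariant G (Y i)) /\
    (forall i, (i < n)%N -> Y i `<` Y i.+1) /\
    Y n = [set: X].

Inductive enat := Fin of nat | Inf.

Definition ele (u v : enat) : Prop :=
  match u, v with
  | Fin m, Fin n => (m <= n)%N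
  | _, Inf => True
  | Inf, Fin _ => False
  end.

Definition is_sup (S : set nat) (v : enat) : Prop :=
  (forall n, S n -> ele (Fin n) v) /\
  (forall u, (forall n, S n -> ele (Fin n) u) -> ele v u).

Definition height_is (X : topologicalType) (G : set (X -> X)) (v : enat) : Prop :=
  is_sup [set n | has_chain G n] v.

Definition P_h (X : topologicalType) : set enat :=
  [set v | exists G : set (X -> X), subgroup_Homeo G /\ height_is G v].

(* Main.v *)
Require Import Defs.
From mathcomp Require Import all_boot all_order all_algebra.
From mathcomp Require Import all_classical all_reals all_analysis.
From mathcomp Require Import ring lra zify.
Import numFieldNormedType.Exports.
Set Implicit Arguments. Unset Strict Implicit. Unset Printing Implicit Defensive.
Import Order.TTheory GRing.Theory Num.Theory.
Local Open Scope classical_set_scope.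
Local Open Scope ring_scope.

(* A chain of closed Homeo(X)-invariant sets is invariant under any subgroup G,
   so h(G,X) >= h(Homeo(X),X), and the trivial group has infinite height.  To
   raise the height by exactly k, decompose X into vertices and open edges with
   as few edges as possible.  Unless X is a circle, a vertex that some
   homeomorphism moves into an edge has exactly two edge ends, which belong to
   different edges, and these could be merged; so Homeo(X) preserves the
   vertices and permutes the edges.  Identify each edge of one Homeo(X)-orbit O
   of edges with the real line, and stratify the line into levels 0, ..., k:
   level 0 is the set of integers, level 1 is a copy of the integers in each gap
   ]n, n+1[, and so on, level k being the rest.  Let G preserve the vertices and
   the levels.  Outside O the orbits of G are those of Homeo(X), while O splits
   into k+1 orbits, the levels.  The union of levels 0, ..., j is closed in O for
   every j, which refines chains by k steps; and each level has all end points of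
   the edges of O in its closure, so no further step can be gained.  For a circle, Homeo(X) has
   height 0 and the same construction is applied to the stabilizer of a point,
   which has height 1. *)

(** * Levels on the line *)

Section OrderAutomorphisms.
Variable R : realType.
Implicit Types (g : R -> R) (x y t : R).

(** The inverse is carried along, so that continuity in both directions follows from monotonicity
    alone. *)
Definition oaut g g' :=
  [/\ cancel g g', cancel g' g, {homo g : x y / x < y} & {homo g' : x y / x < y}].

Lemma oaut_comp g g' f f' : oaut g g' -> oaut f f' -> oaut (g \o f) (f' \o g').
Proof.
move=> [gK g'K gi g'i] [fK f'K fi f'i]; split=> [x|x|x y xy|x y xy] /=.
- by rewrite gK fK.
- by rewrite f'K g'K.
- exact/gi/fi.
- exact/f'i/g'i.
Qed.

Lemma oaut_add z : oaut (fun x => x + z) (fun x => x - z).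
Proof. by split=> [x|x|x y|x y]; rewrite ?addrK ?subrK // ltrD2r. Qed.

Lemma oaut_sym g g' : oaut g g' -> oaut g' g.
Proof. by case. Qed.

Lemma oaut_continuous g g' : oaut g g' -> continuous g.
Proof.
move=> og x; have [gK g'K gi g'i] := og.
apply/cvgrPdist_lt => e e0.
have h1 : g' (g x - e) < x by rewrite -[ltRHS]gK; apply: g'i; rewrite ltrBlDr ltrDl.
have h2 : x < g' (g x + e) by rewrite -[ltLHS]gK; apply: g'i; rewrite ltrDl.
near=> y.
have y1 : g' (g x - e) < y by near: y; exact: lt_nbhsr.
have y2 : y < g' (g x + e) by near: y; exact: lt_nbhsl.
move/gi: y1; move/gi: y2; rewrite !g'K => y2 y1.
by rewrite ltr_distlC y1 y2.
Unshelve. all: by end_near.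
Qed.

(** An increasing bijection of the line onto ]0, 1[ that turns [x] into [- x] when [t] is turned
    into [1 - t]. This symmetry is what lets an edge be reversed without changing levels. *)
Definition logistic x : R := (1 + expR (- x))^-1.
Definition logit t : R := - ln (t^-1 - 1).

Lemma logistic01 x : 0 < logistic x < 1.
Proof.
rewrite /logistic invr_gt0; have := expR_gt0 (- x) => h.
by rewrite addr_gt0 //= invf_lt1 ?ltrDl ?addr_gt0.
Qed.

Lemma logisticK x : logit (logistic x) = x.
Proof. by rewrite /logit /logistic invrK addrAC subrr add0r expRK opprK. Qed.

Lemma logitK t : 0 < t < 1 -> logistic (logit t) = t.
Proof.
move=> /andP[t0 t1]; rewrite /logit /logistic opprK lnK.
  by rewrite addrC subrK invrK.
by rewrite posrE subr_gt0 invf_gt1.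
Qed.

Lemma logistic_lt : {mono logistic : x y / x < y}.
Proof.
move=> x y; rewrite /logistic ltf_pV2 ?posrE ?addr_gt0 ?expR_gt0 //.
by rewrite ltrD2l ltr_expR ltrN2.
Qed.

Lemma logit_lt s t : 0 < s < 1 -> 0 < t < 1 -> (logit s < logit t) = (s < t).
Proof. by move=> s01 t01; rewrite -logistic_lt !logitK. Qed.

Lemma logitN t : 0 < t < 1 -> logit (1 - t) = - logit t.
Proof.
move=> t01; have : logistic (- logit t) = 1 - t.
  rewrite -{2}[t]logitK // /logistic opprK expRN.
  have := expR_gt0 (logit t); set e := expR _ => e0.
  by field; rewrite !gt_eqF //; nra.
by move=> <-; rewrite logisticK.
Qed.

(** The conjugate of [g] by [logistic], acting in one gap. An increasing bijection of the open gap
    glues with the identity outside it to an increasing bijection of the line. *)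
Definition graft n g x :=
  if n < x < n + 1 then n + logistic (g (logit (x - n))) else x.

Lemma graft_in n g x : n < x < n + 1 -> n < graft n g x < n + 1.
Proof.
move=> h; rewrite /graft h; have /andP[a b] := logistic01 (g (logit (x - n))).
by rewrite ltrDl a ltrD2l b.
Qed.

Lemma graft_out n g x : ~~ (n < x < n + 1) -> graft n g x = x.
Proof. by rewrite /graft => /negPf ->. Qed.

Lemma graftE n g x : n < x < n + 1 ->
  logit (graft n g x - n) = g (logit (x - n)).
Proof. by rewrite /graft => ->; rewrite addrAC subrr add0r logisticK. Qed.

Lemma subn01 n x : (0 < x - n < 1) = (n < x < n + 1).
Proof. by rewrite subr_gt0 ltrBlDl. Qed.

Lemma graftK n g g' : cancel g g' -> cancel (graft n g) (graft n g').
Proof.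
move=> gK x; case: (boolP (n < x < n + 1)) => h; last first.
  by rewrite (graft_out _ h) graft_out.
rewrite {1}/graft graft_in // graftE // gK logitK ?subn01 //.
by rewrite addrC subrK.
Qed.

Lemma graft_homo n g : {homo g : x y / x < y} -> {homo graft n g : x y / x < y}.
Proof.
move=> gi x y xy.
case: (boolP (n < x < n + 1)) => hx; case: (boolP (n < y < n + 1)) => hy.
- rewrite /graft hx hy ltrD2l logistic_lt; apply: gi.
  by rewrite logit_lt ?subn01 // ltrD2r.
- rewrite (graft_out _ hy); have /andP[_ h2] := graft_in g hx.
  apply: (lt_le_trans h2); move: hy; rewrite negb_and -!leNgt => /orP[] //.
  by move=> yn; move: hx xy; lra.
- rewrite (graft_out _ hx); have /andP[h2 _] := graft_in g hy.
  apply: le_lt_trans h2; move: hx; rewrite negb_and -!leNgt => /orP[] //.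
  by move=> yn; move: hy xy; lra.
- by rewrite !graft_out.
Qed.

Lemma oaut_graft n g g' : oaut g g' -> oaut (graft n g) (graft n g').
Proof. by move=> [gK g'K gi g'i]; split; [exact: graftK|exact: graftK|exact: graft_homo|exact: graft_homo]. Qed.

(* One refinement step: the integers become the lowest level, and every gap
   ]n, n+1[ carries a copy of the levels of [L], shifted up by one. *)
Definition refine (L : R -> nat) x : nat :=
  if x == (Num.floor x)%:~R then 0%N
  else (L (logit (x - (Num.floor x)%:~R))).+1.

Lemma refine_int L (n : int) : refine L n%:~R = 0%N.
Proof. by rewrite /refine intrKfloor eqxx. Qed.

Lemma refine_gap L (n : int) x : n%:~R < x < n%:~R + 1 ->
  refine L x = (L (logit (x - n%:~R))).+1.
Proof.
move=> /andP[h1 h2]; have e : Num.floor x = n.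
  by apply: floor_def; rewrite (ltW h1) rmorphD.
by rewrite /refine e gt_eqF.
Qed.

Lemma int_or_gap x : (exists n : int, x = n%:~R) \/
  (exists n : int, n%:~R < x < n%:~R + 1).
Proof.
have h1 := floor_le x; have h2 := floorD1_gt x.
move: h1 h2; rewrite intrD1 => h1 h2.
move: h1; rewrite le_eqVlt => /orP[/eqP h1|h1]; [left|right]; exists (Num.floor x) => //.
by rewrite h1.
Qed.

(** The third clause serves twice: reflection allows edges to be reversed, and integer translations
    make every level accumulate at both ends of the line. The fourth says that the sets [L > j] are
    open, the fifth that each level is a single orbit of the level-preserving automorphisms. *)
Definition levels (k : nat) (L : R -> nat) :=
  [/\ forall x, (L x <= k)%N,
      forall j, (j <= k)%N -> exists x, L x = j,
      (forall x, L (- x) = L x) /\ (forall x (z : int), L (x + z%:~R) = L x),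
      forall j x, (j < L x)%N -> exists a b : R, a < x < b /\
        forall y, a < y < b -> (j < L y)%N
    & forall x y, L x = L y ->
        exists g g', [/\ oaut g g', g x = y & forall z, L (g z) = L z]].

Lemma levels0 : levels 0 (fun _ => 0%N).
Proof.
split=> // [j|x y _].
  by rewrite leqn0 => /eqP ->; exists 0.
exists (fun z => z + (y - x)), (fun z => z - (y - x)); split=> //.
  exact: oaut_add.
by rewrite addrC subrK.
Qed.

Lemma refine_graft L (n : int) g : (forall z, L (g z) = L z) ->
  forall z, refine L (graft n%:~R g z) = refine L z.
Proof.
move=> gL z; case: (boolP (n%:~R < z < n%:~R + 1)) => h; last by rewrite graft_out.
by rewrite (refine_gap _ (graft_in g h)) (refine_gap _ h) graftE // gL.
Qed.

(** Homogeneity: two integers differ by an integer translation. Two points of equal positive level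
    are first brought into the same gap by a translation, then matched there by grafting an
    automorphism that preserves [L]. *)
Lemma levels_refine k L : levels k L -> levels k.+1 (refine L).
Proof.
move=> [Lk Lj [LN LD] Lo Lt].
have RD x (z : int) : refine L (x + z%:~R) = refine L x.
  have [[n ->]|[n h]] := int_or_gap x; first by rewrite -intrD !refine_int.
  rewrite (@refine_gap _ (n + z)) ?(refine_gap _ h); last first.
    by rewrite intrD; lra.
  by rewrite intrD opprD addrACA subrr addr0.
split.
- by move=> x; rewrite /refine; case: ifP => // _; rewrite ltnS.
- case=> [_|j]; first by exists 0%:~R; exact: refine_int.
  rewrite ltnS => /Lj [x <-]; exists (logistic x).
  have /andP[h1 h2] := logistic01 x.
  by rewrite (@refine_gap _ 0) ?subr0 ?add0r ?h1 ?logisticK.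
- split=> // x; have [[n ->]|[n h]] := int_or_gap x.
    by rewrite -rmorphN !refine_int.
  (* Reflection sends ]n, n+1[ to ]-n-1, -n[, and in the coordinates of the two gaps it becomes [t]
     to [1 - t]. *)
  rewrite (@refine_gap _ (- n - 1)) ?(refine_gap _ h); last first.
    by rewrite intrD !rmorphN /= ; lra.
  have -> : - x - (- n - 1)%:~R = 1 - (x - n%:~R).
    by rewrite intrD !rmorphN /=; ring.
  by rewrite logitN ?subn01 // LN.
- move=> j x; have [[n ->]|[n h]] := int_or_gap x; first by rewrite refine_int.
  rewrite (refine_gap _ h); have hx := h; move/andP: h => [h1 h2].
  case: j => [_|j].
    by exists n%:~R, (n%:~R + 1); split=> // y hy; rewrite (refine_gap _ hy).
  rewrite ltnS => /Lo [a [b [ab abL]]].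
  exists (n%:~R + logistic a), (n%:~R + logistic b).
  have xn : 0 < x - n%:~R < 1 by rewrite subn01 h1.
  move/andP: ab => [ax xb]; split.
    move: ax xb; rewrite -(logistic_lt a) -(logistic_lt _ b) logitK // => ax xb.
    by rewrite -ltrBrDl ax -ltrBlDl xb.
  move=> y /andP[y1 y2].
  have /andP[a0 _] := logistic01 a; have /andP[_ b1] := logistic01 b.
  have hy : n%:~R < y < n%:~R + 1 by rewrite (lt_trans _ y1) ?ltrDl //= (lt_trans y2) ?ltrD2l.
  rewrite (refine_gap _ hy) ltnS; apply: abL.
  by rewrite -(logistic_lt a) -(logistic_lt _ b) logitK ?subn01 // ltrBrDl ltrBlDl y1.
- move=> x y; have [[n ->]|[n hx]] := int_or_gap x; have [[m ->]|[m hy]] := int_or_gap y.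
  + move=> _; exists (fun z => z + (m - n)%:~R), (fun z => z - (m - n)%:~R).
    split=> [||z]; [exact: oaut_add|by rewrite intrB addrC subrK|exact: RD].
  + by rewrite refine_int (refine_gap _ hy).
  + by rewrite refine_int (refine_gap _ hx).
  + set x1 := x + (m - n)%:~R.
    have hx1 : m%:~R < x1 < m%:~R + 1 by rewrite /x1 intrB; lra.
    rewrite -(RD x (m - n)) -/x1 (refine_gap _ hx1) (refine_gap _ hy) => -[].
    move=> /Lt [g [g' [og gx gL]]].
    exists (graft m%:~R g \o (fun z => z + (m - n)%:~R)).
    exists ((fun z => z - (m - n)%:~R) \o graft m%:~R g').
    split=> [||z].
    * by apply: oaut_comp; [exact: oaut_graft|exact: oaut_add].
    * by rewrite /= -/x1 /graft hx1 gx logitK ?subn01 // addrC subrK.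
    * by rewrite /= refine_graft.
Qed.

Lemma exists_levels k : exists L, levels k L.
Proof.
elim: k => [|k [L h]]; first by eexists; exact: levels0.
by eexists; exact: levels_refine h.
Qed.

(** The same structure on ]0, 1[: translation invariance has become accumulation of every level at
    0, hence at 1 by symmetry, and the automorphisms fix 0 and 1 so that they extend to closed
    edges. *)
Definition edge_levels (k : nat) (L : R -> nat) :=
  [/\ forall t, (L t <= k)%N,
      forall j, (j <= k)%N -> forall e : R, 0 < e -> exists t : R, [/\ 0 < t < 1, t < e & L t = j],
      forall t : R, 0 < t < 1 -> L (1 - t) = L t,
      forall j (t : R), 0 < t < 1 -> (j < L t)%N -> exists a b : R, a < t < b /\
        forall s, a < s < b -> 0 < s < 1 /\ (j < L s)%N
    & forall s t : R, 0 < s < 1 -> 0 < t < 1 -> L s = L t ->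
        exists g g', [/\ oaut g g', g s = t, g 0 = 0, g 1 = 1
          & forall r : R, 0 < r < 1 -> L (g r) = L r]].

Lemma exists_edge_levels k : exists L, edge_levels k L.
Proof.
have [L [Lk Lj [LN LD] Lo Lt]] := exists_levels k.
exists (L \o logit); split=> /=.
- by move=> t; exact: Lk.
- move=> j /Lj [x xj] e e0.
  set e' := Num.min e (1 / 2).
  have e'0 : 0 < e' < 1.
    by rewrite lt_min gt_min e0 /= !(ltr_pdivlMr, ltr_pdivrMr) //; apply/andP; split; [lra|apply/orP; right; lra].
  (* An integer translation keeps the level of [x] and moves it below [logit e']; the bound 1/2 in
     [e'] keeps [e'] in the domain of [logit]. *)
  pose n := Num.floor (logit e' - x).
  have nx : x + n%:~R < logit e' + 1.
    have := floor_le (logit e' - x); rewrite -/n; lra.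
  have nx1 : x + (n - 1)%:~R < logit e' by rewrite intrB; lra.
  exists (logistic (x + (n - 1)%:~R)); split; first exact: logistic01.
    rewrite -logistic_lt logitK // in nx1; apply: (lt_le_trans nx1).
    by rewrite ge_min lexx.
  by rewrite logisticK LD.
- by move=> t t01; rewrite logitN.
- move=> j t t01 /Lo [a [b [/andP[at_ tb] ab]]].
  exists (logistic a), (logistic b); split.
    by rewrite -[t]logitK // !logistic_lt at_.
  move=> s /andP[s1 s2].
  have s01 : 0 < s < 1.
    have /andP[a0 _] := logistic01 a; have /andP[_ b1] := logistic01 b.
    by rewrite (lt_trans a0 s1) (lt_trans s2 b1).
  by split=> //; apply: ab; rewrite -(logistic_lt a) -(logistic_lt _ b) logitK // s1.
- move=> s t s01 t01 /Lt [g [g' [og gst gL]]].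
  (* Grafting into ]0, 1[ is conjugation by [logistic], and it leaves 0 and 1 alone. *)
  exists (graft 0 g), (graft 0 g').
  have z (r : R) : (0 < r < 0 + 1) = (0 < r < 1) by rewrite add0r.
  split.
  + exact: oaut_graft.
  + by rewrite /graft z s01 subr0 gst add0r logitK.
  + by rewrite graft_out // ltxx.
  + by rewrite graft_out // add0r ltxx andbF.
  + move=> r r01; have := @graftE 0 g r; rewrite z !subr0 => -> //.
Qed.

End OrderAutomorphisms.

(** * Edge decompositions *)

(** Within [A] the set [U] is also the complement of [W], hence clopen. *)
Lemma connected_sub_open (T : topologicalType) (A U W : set T) :
  connected A -> open U -> open W -> A `<=` U `|` W -> A `&` U `&` W = set0 ->
  A `&` U !=set0 -> A `<=` U.
Proof.
move=> Ac oU oW AUW d AU0; apply/setIidPl; apply: Ac => //.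
  by exists U.
exists (~` W); first exact: open_closedC.
apply/seteqP; split=> x [Ax hx]; split=> //.
  by move=> Wx; rewrite -[False]/(set0 x) -d.
by case: (AUW _ Ax).
Qed.

Lemma finite_closed_bigcup (T : topologicalType) (I : finType) (D : set I)
    (A : I -> set T) :
  (forall i, D i -> closed (A i)) -> closed (\bigcup_(i in D) A i).
Proof. by move=> h; apply: closed_bigcup => //; exact: finite_finset. Qed.

Lemma preimage_limit (R : realType) (T : topologicalType) (f : R -> T) (C : set T) (a : R) :
  closed C -> {for a, continuous f} ->
  (forall e : R, 0 < e -> exists2 t : R, `|a - t| < e & C (f t)) -> C (f a).
Proof.
move=> cC fc h; apply: contrapT => nC.
have : nbhs (f a) (~` C) by apply: open_nbhs_nbhs; split=> //; exact: closed_openC.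
move=> /fc /nbhs_ballP [e /= e0 he].
by have [t /he] := h e e0.
Qed.

(** A point inside an edge determines the edge and its parameter, while end points may be identified
    at will, so loops and multiple edges are allowed. Taking functions continuous on the whole line
    avoids subspace topologies. *)
Definition edge_decomposition (R : realType) (X : topologicalType) (I : finType)
    (phi : I -> R -> X) : Prop :=
  [/\ forall i, continuous (phi i),
      forall x, exists i (t : R), 0 <= t <= 1 /\ x = phi i t
    & forall i j (s t : R), 0 < s < 1 -> 0 <= t <= 1 -> phi i s = phi j t -> i = j /\ s = t].

Definition vertex (R : realType) (X : topologicalType) (I : finType)
  (phi : I -> R -> X) : set X := [set x | exists i, x = phi i 0 \/ x = phi i 1].

Definition edge_point (R : realType) (X : topologicalType) (I : finType)
    (phi : I -> R -> X) (O : set I) : set X :=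
  [set x | exists i (t : R), [/\ O i, 0 < t < 1 & x = phi i t]].

Section EdgeDecomposition.
Variables (R : realType) (X : topologicalType).
Hypothesis Xh : hausdorff_space X.
Variables (I : finType) (phi : I -> R -> X).
Hypothesis dec : edge_decomposition phi.

Local Notation vertex := (vertex phi).
Local Notation edge_point := (edge_point phi).

Let phic i : continuous (phi i). Proof. by case: dec. Qed.
Let cover x : exists i (t : R), 0 <= t <= 1 /\ x = phi i t. Proof. by case: dec. Qed.
Let disj i j (s t : R) : 0 < s < 1 -> 0 <= t <= 1 -> phi i s = phi j t -> i = j /\ s = t.
Proof. by case: dec => _ _; apply. Qed.

Let oc (t : R) : 0 < t < 1 -> 0 <= t <= 1.
Proof. by move=> /andP[a b]; rewrite !ltW. Qed.

Lemma closed01 (i : I) (K : set R) : closed K -> K `<=` [set t : R | 0 <= t <= 1] ->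
  closed (phi i @` K).
Proof.
move=> cK K01; apply: compact_closed => //.
apply: continuous_compact; first exact/continuous_subspaceT/phic.
apply: (subclosed_compact cK (@segment_compact R 0 1)) => t /K01 /=.
by rewrite in_itv.
Qed.

Lemma unit_closed : closed [set t : R | 0 <= t <= 1].
Proof.
by have := @itv_closed _ R 0 1; congr closed; apply/seteqP; split=> x /=; rewrite in_itv.
Qed.

Lemma edge_closed i : closed (phi i @` [set t : R | 0 <= t <= 1]).
Proof. by apply: closed01 => //; exact: unit_closed. Qed.

(** The complement is a finite union of compact sets: the other closed edges and the remaining part
    of the edge [i]. *)
Lemma edge_open i (U : set R) : open U -> U `<=` [set t : R | 0 < t < 1] ->
  open (phi i @` U).
Proof.
move=> oU U01; rewrite -[phi i @` U]setCK; apply: closed_openC.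
have -> : ~` (phi i @` U) = (\bigcup_(j in [set j | j != i]) phi j @` [set t : R | 0 <= t <= 1])
   `|` phi i @` ([set t : R | 0 <= t <= 1] `&` ~` U).
  apply/seteqP; split=> x.
    move=> nU; have [j [t [t01 xE]]] := cover x.
    case: (eqVneq j i) => [ji|ji]; [right|left].
      by exists t; rewrite -?ji //; split=> // Ut; apply: nU; exists t; rewrite // -ji.
    by exists j => //; exists t.
  move=> [[j /= ji [t t01 <-]]|[t [t01 nUt] <-]] [s Us /(disj (U01 _ Us))] .
    by case=> // /esym/eqP; rewrite (negPf ji).
  by case=> // _ st; apply: nUt; rewrite -st.
apply: closedU.
  by apply: finite_closed_bigcup => j _; exact: edge_closed.
apply: closed01 => [|t [] //]; apply: closedI; first exact: unit_closed.
exact: open_closedC.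
Qed.

Lemma unit_open : open [set t : R | 0 < t < 1].
Proof.
by have := @itv_open _ R 0 1; congr open; apply/seteqP; split=> x /=; rewrite in_itv.
Qed.

Lemma vertexPn x : ~ vertex x <-> edge_point setT x.
Proof.
split=> [nv|[i [t [_ t01 ->]]] [j [] /(disj t01)]].
- have [i [t [/andP[t0 t1] xE]]] := cover x; exists i, t; split=> //.
  rewrite !lt_neqAle t0 t1 !andbT; apply/andP; split; apply/eqP => tE; apply: nv.
    by exists i; left; rewrite tE.
  by exists i; right; rewrite -tE.
- by case=> [|_ h]; rewrite ?lexx ?ler01 // -h ltxx in t01 *; case/andP: t01.
- by case=> [|_ h]; rewrite ?lexx ?ler01 //; move: t01; rewrite h ltxx andbF.
Qed.

Lemma edge_nvertex i t : 0 < t < 1 -> ~ vertex (phi i t).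
Proof. by move=> t01; apply/vertexPn; exists i, t. Qed.

Lemma edge_point_open O : open (edge_point O).
Proof.
have -> : edge_point O = \bigcup_(i in O) phi i @` [set t : R | 0 < t < 1].
  apply/seteqP; split=> [x [i [t [Oi t01 ->]]]|x [i Oi [t t01 <-]]].
    by exists i => //; exists t.
  by exists i, t.
by apply: bigcup_open => i _; apply: edge_open => //; exact: unit_open.
Qed.

(** The two prescriptions agree at the ends of the edges of [O]. The preimage of a closed set is
    then a finite union of closed sets, one outside the open edges of [O] and one in each closed
    edge of [O]. *)
Lemma glue (O : set I) (h : X -> X) (s : I -> I) (g : I -> R -> R) :
  continuous h -> (forall i, continuous (g i)) ->
  (forall i, O i -> h (phi i 0) = phi (s i) (g i 0)) ->
  (forall i, O i -> h (phi i 1) = phi (s i) (g i 1)) ->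
  exists u : X -> X, [/\ continuous u, forall x, ~ edge_point O x -> u x = h x
    & forall i t, O i -> 0 <= t <= 1 -> u (phi i t) = phi (s i) (g i t)].
Proof.
move=> hc gc h0 h1.
have /choice[u uP] : forall x, exists y, (~ edge_point O x -> y = h x) /\
    (forall i t, O i -> 0 < t < 1 -> x = phi i t -> y = phi (s i) (g i t)).
  move=> x; have [[i [t [Oi t01 xE]]]|nx] := pselect (edge_point O x).
    exists (phi (s i) (g i t)); split=> [[]|j r Oj r01]; first by exists i, t.
    by rewrite xE => /(disj t01)[]; [exact: oc|move=> -> ->].
  by exists (h x); split=> // i t Oi t01 xE; case: nx; exists i, t.
have u1 x : ~ edge_point O x -> u x = h x by case: (uP x).
have nv x : vertex x -> ~ edge_point O x.
  by move=> vx [i [t [_ t01 xE]]]; apply: (@edge_nvertex i t); rewrite -?xE.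
have u2 i t : O i -> 0 <= t <= 1 -> u (phi i t) = phi (s i) (g i t).
  move=> Oi /andP[]; rewrite !le_eqVlt => /orP[/eqP <-|t0].
    by move=> _; rewrite u1 ?h0 //; apply: nv; exists i; left.
  move=> /orP[/eqP ->|t1].
    by rewrite u1 ?h1 //; apply: nv; exists i; right.
  by case: (uP (phi i t)) => _; apply=> //; rewrite t0.
exists u; split=> //; apply/continuous_closedP => C cC.
have -> : u @^-1` C = (~` edge_point O `&` h @^-1` C) `|`
   \bigcup_(i in O) phi i @` ([set t : R | 0 <= t <= 1] `&` (phi (s i) \o g i) @^-1` C).
  apply/seteqP; split=> x /=.
    have [[i [t [Oi t01 ->]]]|nx] := pselect (edge_point O x).
      move=> Cu; right; exists i => //; exists t => //; split; first exact: oc.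
      by rewrite /= -u2 //; exact: oc.
    by move=> Cu; left; split=> //; rewrite -u1.
  move=> [[nx Cx]|[i Oi [t [t01 Ct] <-]]]; first by rewrite u1.
  by rewrite u2.
apply: closedU.
  apply: closedI; first exact: open_closedC (edge_point_open O).
  by move/continuous_closedP: hc; exact.
apply: finite_closed_bigcup => i _; apply: closed01 => [|t [] //].
apply: closedI; first exact: unit_closed.
have /continuous_closedP : continuous (phi (s i) \o g i); last exact.
by move=> t; apply: continuous_comp; [exact: gc|exact: phic].
Qed.

(** The image of an open edge is connected and avoids the vertices, so it stays in the open edge
    that contains the image of the midpoint. *)
Lemma edge_image (h : X -> X) : continuous h -> (forall x, vertex (h x) -> vertex x) ->
  forall i, exists j, forall t : R, 0 < t < 1 -> exists2 r : R, 0 < r < 1 & h (phi i t) = phi j r.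
Proof.
move=> hc hv i.
have nvh t : 0 < t < 1 -> edge_point setT (h (phi i t)).
  by move=> t01; apply/vertexPn => /hv; exact: edge_nvertex.
have half : 0 < (1 / 2 : R) < 1 by apply/andP; split; lra.
have [j [r [_ r01 hr]]] := nvh _ half; exists j.
suff : (h \o phi i) @` [set t : R | 0 < t < 1] `<=` phi j @` [set t : R | 0 < t < 1].
  by move=> sub t t01; have [|q q01 /= <-] := sub (h (phi i t)); [exists t|exists q].
apply: (@connected_sub_open _ _ _ (edge_point [set~ j])).
- apply: connected_continuous_connected.
    apply/connected_intervalP => a b /= /andP[a0 a1] /andP[b0 b1] c /andP[ac cb].
    by rewrite (lt_le_trans a0 ac) (le_lt_trans cb b1).
  apply: continuous_subspaceT => t; apply: continuous_comp; [exact: phic|exact: hc].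
- by apply: edge_open => //; exact: unit_open.
- exact: edge_point_open.
- move=> _ [t t01 <-]; have [k [q [_ q01 /= qE]]] := nvh _ t01.
  have [kj|kj] := pselect (k = j); first by left; exists q; rewrite ?qE ?kj.
  by right; exists k, q.
- apply/seteqP; split=> // _ [[_ [t t01 <-]]] [k [q [kj q01 qE]]].
  by apply: kj; move/esym: qE => /disj[] //; exact: oc.
- by exists (phi j r); split; [exists (1 / 2)|exists r].
Qed.

End EdgeDecomposition.

(** * The stabilizer of the vertices *)

Section Stabilizer.
Variables (R : realType) (X : topologicalType).
Hypothesis Xh : hausdorff_space X.
Variables (I : finType) (phi : I -> R -> X).
Hypothesis dec : edge_decomposition phi.

Local Notation vertex := (vertex phi).
Local Notation edge_point := (edge_point phi).

Let phic i : continuous (phi i). Proof. by case: dec. Qed.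
Let disj i j (s t : R) : 0 < s < 1 -> 0 <= t <= 1 -> phi i s = phi j t -> i = j /\ s = t.
Proof. by case: dec => _ _; apply. Qed.
Let oc (t : R) : 0 < t < 1 -> 0 <= t <= 1.
Proof. by move=> /andP[a b]; rewrite !ltW. Qed.
Let disjo i j (s t : R) : 0 < s < 1 -> 0 < t < 1 -> phi i s = phi j t -> i = j /\ s = t.
Proof. by move=> s01 t01; apply: disj => //; exact: oc. Qed.
Let half : 0 < (1 / 2 : R) < 1. Proof. by apply/andP; split; lra. Qed.

Definition vertex_stab : set (X -> X) :=
  [set h | is_homeo X h /\ forall x, vertex (h x) <-> vertex x].

Lemma is_homeo_id : is_homeo X id.
Proof. by split; [move=> x; exact: cvg_id|exists id; split=> [x|//]; exact: cvg_id]. Qed.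

Lemma is_homeo_comp (f g : X -> X) : is_homeo X f -> is_homeo X g -> is_homeo X (f \o g).
Proof.
move=> [fc [f' [f'c [fK f'K]]]] [gc [g' [g'c [gK g'K]]]]; split.
  by move=> x; apply: continuous_comp; [exact: gc|exact: fc].
exists (g' \o f'); split; first by move=> x; apply: continuous_comp; [exact: f'c|exact: g'c].
by split; apply: can_comp.
Qed.

Lemma vertex_stab_id : vertex_stab id.
Proof. by split=> //; exact: is_homeo_id. Qed.

Lemma vertex_stab_comp f g : vertex_stab f -> vertex_stab g -> vertex_stab (f \o g).
Proof.
by move=> [hf vf] [hg vg]; split; [exact: is_homeo_comp|move=> x /=; rewrite vf].
Qed.

Lemma vertex_stab_inv f : vertex_stab f ->
  exists g, [/\ vertex_stab g, cancel f g & cancel g f].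
Proof.
move=> [[fc [f' [f'c [fK f'K]]]] vf]; exists f'; split=> //; split.
  by split=> //; exists f.
by move=> x; rewrite -vf f'K.
Qed.

Let maps_edges (h : X -> X) (s : I -> I) :=
  forall i (t : R), 0 < t < 1 -> exists2 r : R, 0 < r < 1 & h (phi i t) = phi (s i) r.

Let edge_perm h : vertex_stab h -> exists s, maps_edges h s.
Proof.
move=> [[hc _] hv].
by have /choice[s sP] := edge_image Xh dec hc (fun x => proj1 (hv x)); exists s.
Qed.

Let edge_permK h h' s s' : cancel h h' -> maps_edges h s -> maps_edges h' s' -> cancel s s'.
Proof.
move=> hK hs h's' i; have [r r01 hr] := hs i _ half; have [q q01] := h's' (s i) _ r01.
by rewrite -hr hK => /disjo[] //.
Qed.

Definition flip (b : bool) (t : R) := if b then 1 - t else t.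

Lemma flipK b : involutive (flip b).
Proof. by case: b => t //=; rewrite opprB addrC subrK. Qed.

Lemma flip01 b t : 0 < t < 1 -> 0 < flip b t < 1.
Proof. by case: b => //= /andP[? ?]; apply/andP; split; lra. Qed.

Lemma flip_continuous b : continuous (flip b).
Proof.
case: b => t /=; last exact: cvg_id.
by apply: cvgB; [exact: cvg_cst|exact: cvg_id].
Qed.

(** The image is a limit of points of the edge [s i], hence lies on that closed edge; being a
    vertex, it is one of its end points. *)
Let endpoint_image h s i (e : R) : vertex_stab h -> maps_edges h s -> e = 0 \/ e = 1 ->
  h (phi i e) = phi (s i) 0 \/ h (phi i e) = phi (s i) 1.
Proof.
move=> [[hc _] hv] hs e01.
have [t t01 tE] : (phi (s i) @` [set t : R | 0 <= t <= 1]) (h (phi i e)).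
  apply: (@preimage_limit _ _ (h \o phi i)).
  - exact: edge_closed.
  - by apply: continuous_comp; [exact: phic|exact: hc].
  - move=> d d0; pose r := Num.min (d / 2) (1 / 2).
    have [r0 rd r1] : [/\ 0 < r, r < d & r < 1].
      by split; rewrite /r ?lt_min ?gt_min; lra.
    exists (flip (e == 1) r).
      by case: e01 => ->; rewrite ?eqxx /= ?(eq_sym 0) ?oner_eq0 /= ?sub0r ?normrN ?subKr gtr0_norm.
    have [|q q01 qE] := hs i (flip (e == 1) r); first by apply: flip01; rewrite r0.
    by rewrite /= qE; exists q => //; exact: oc.
move: t01 => /andP[]; rewrite !le_eqVlt => /orP[/eqP t0|t0].
  by left; rewrite -tE -t0.
move=> /orP[/eqP t1|t1]; first by right; rewrite -tE t1.
have : vertex (h (phi i e)) by apply/hv; exists i; case: e01 => ->; [left|right].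
by rewrite -tE => /(edge_nvertex dec) []; rewrite t0.
Qed.

(** The inverse shows that both end points of [s i] are attained. If the two images coincide, [s i]
    is therefore a loop and either orientation will do. *)
Let endpoints h h' s s' : vertex_stab h -> vertex_stab h' -> cancel h h' -> cancel h' h ->
  maps_edges h s -> maps_edges h' s' ->
  forall i, exists b, h (phi i 0) = phi (s i) (flip b 0) /\ h (phi i 1) = phi (s i) (flip b 1).
Proof.
move=> Bh Bh' hK h'K hs h's' i.
have ss' := edge_permK hK hs h's'.
have a0 := endpoint_image i Bh hs (or_introl erefl).
have a1 := endpoint_image i Bh hs (or_intror erefl).
have E (e : R) : e = 0 \/ e = 1 -> phi (s i) e = h (phi i 0) \/ phi (s i) e = h (phi i 1).
  move=> /(endpoint_image (s i) Bh' h's'); rewrite ss' => -[] /(congr1 h); rewrite h'K => ->.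
    by left.
  by right.
have b0 := E 0 (or_introl erefl).
have b1 := E 1 (or_intror erefl).
have : (h (phi i 0) = phi (s i) 0 /\ h (phi i 1) = phi (s i) 1) \/
       (h (phi i 0) = phi (s i) 1 /\ h (phi i 1) = phi (s i) 0).
  by case: a0 a1 b0 b1 => -> [] -> [] E0 [] E1; auto.
case=> [h01|[h0 h1]]; first by exists false.
by exists true; rewrite /flip subr0 subrr.
Qed.

(** Gluing the inverse data gives the inverse map. *)
Let glue_homeo (O : set I) (h h' : X -> X) (s s' : I -> I) (g g' : I -> R -> R) :
  continuous h -> continuous h' -> cancel h h' -> cancel h' h ->
  cancel s s' -> cancel s' s -> (forall i, O (s i) <-> O i) ->
  (forall x, edge_point O (h x) <-> edge_point O x) ->
  (forall i, continuous (g i)) -> (forall i, continuous (g' i)) ->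
  (forall i (t : R), 0 < t < 1 -> 0 < g i t < 1) ->
  (forall i (t : R), 0 < t < 1 -> 0 < g' i t < 1) ->
  (forall i, cancel (g i) (g' (s i))) -> (forall i, cancel (g' i) (g (s' i))) ->
  (forall i, O i -> h (phi i 0) = phi (s i) (g i 0)) ->
  (forall i, O i -> h (phi i 1) = phi (s i) (g i 1)) ->
  (forall i, O i -> h' (phi i 0) = phi (s' i) (g' i 0)) ->
  (forall i, O i -> h' (phi i 1) = phi (s' i) (g' i 1)) ->
  exists u : X -> X, [/\ is_homeo X u, forall x, ~ edge_point O x -> u x = h x
    & forall i (t : R), O i -> 0 <= t <= 1 -> u (phi i t) = phi (s i) (g i t)].
Proof.
move=> hc h'c hK h'K sK s'K Os Oh gc g'c g01 g'01 gK g'K h0 h1 h'0 h'1.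
have [u [uc uN uO]] := glue Xh dec hc gc h0 h1.
have [u' [u'c u'N u'O]] := glue Xh dec h'c g'c h'0 h'1.
exists u; split=> //; split=> //; exists u'; split=> //; split=> x.
- have [[i [t [Oi t01 ->]]]|nx] := pselect (edge_point O x).
    rewrite uO ?u'O ?sK ?gK //; last exact: oc.
      exact/Os.
    by apply: oc; exact: g01.
  by rewrite uN // u'N ?hK // Oh.
- have [[i [t [Oi t01 ->]]]|nx] := pselect (edge_point O x).
    rewrite u'O ?uO ?s'K ?g'K //; last exact: oc.
      by apply/Os; rewrite s'K.
    by apply: oc; exact: g'01.
  by rewrite u'N // uN ?h'K // -Oh h'K.
Qed.

Let vertex_fix (O : set I) (h u : X -> X) (s : I -> I) (g : I -> R -> R) :
  vertex_stab h -> (forall x, edge_point O (h x) <-> edge_point O x) ->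
  (forall x, ~ edge_point O x -> u x = h x) ->
  (forall i (t : R), O i -> 0 <= t <= 1 -> u (phi i t) = phi (s i) (g i t)) ->
  (forall i (t : R), 0 < t < 1 -> 0 < g i t < 1) ->
  forall x, vertex (u x) <-> vertex x.
Proof.
move=> [_ hv] Oh uN uO g01 x.
have [[i [t [Oi t01 ->]]]|nx] := pselect (edge_point O x); last by rewrite uN.
rewrite uO //; last exact: oc.
by split=> /(edge_nvertex dec) []; [exact: g01|].
Qed.

Lemma vertex_stab_shift (O : set I) (g g' : R -> R) : oaut g g' -> g 0 = 0 -> g 1 = 1 ->
  exists u, [/\ vertex_stab u, forall x, ~ edge_point O x -> u x = x
    & forall i (t : R), O i -> 0 <= t <= 1 -> u (phi i t) = phi i (g t)].
Proof.
move=> og g0 g1; have [gK g'K gi g'i] := og.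
have g'0 : g' 0 = 0 by rewrite -g0 gK.
have g'1 : g' 1 = 1 by rewrite -g1 gK.
have g01 t : 0 < t < 1 -> 0 < g t < 1.
  by move=> /andP[/gi t0 /gi t1]; rewrite -g0 -g1 t0.
have g'01 t : 0 < t < 1 -> 0 < g' t < 1.
  by move=> /andP[/g'i t0 /g'i t1]; rewrite -g'0 -g'1 t0.
have cid : continuous (@id X) by move=> x; exact: cvg_id.
have [//|//|//|//|//|//|i|i|//|//|//|//|i _|i _|i _|i _|u [uh uN uO]] :=
  @glue_homeo O id id id id (fun=> g) (fun=> g') cid cid.
- exact: oaut_continuous og.
- exact: oaut_continuous (oaut_sym og).
- by rewrite g0.
- by rewrite g1.
- by rewrite g'0.
- by rewrite g'1.
exists u; split=> //; split=> //.
by apply: (@vertex_fix O id u id (fun=> g)) => //; exact: vertex_stab_id.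
Qed.

Variable i0 : I.

(** Edges are followed through the image of a midpoint, which determines the image edge because the
    stabilizer permutes the open edges. *)
Definition edge_orbit : set I :=
  [set i | exists h (r : R), [/\ vertex_stab h, 0 < r < 1 & h (phi i0 (1 / 2)) = phi i r]].

Local Notation O := edge_orbit.

Lemma edge_orbit_id : O i0.
Proof. by exists id, (1 / 2); split=> //; exact: vertex_stab_id. Qed.

Let edge_orbitP h s i : vertex_stab h -> maps_edges h s -> O i -> O (s i).
Proof.
move=> Bh hs [f [r [Bf r01 fr]]]; have [q q01 qE] := hs i r r01.
by exists (h \o f), q; split=> //=; [exact: vertex_stab_comp|rewrite fr].
Qed.

Lemma edge_orbit_stab h x : vertex_stab h -> edge_point O (h x) <-> edge_point O x.
Proof.
have sub f y : vertex_stab f -> edge_point O y -> edge_point O (f y).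
  move=> Bf [i [t [Oi t01 ->]]]; have [s fs] := edge_perm Bf.
  have [r r01 ->] := fs i t t01; exists (s i), r; split=> //; exact: (edge_orbitP Bf fs Oi).
move=> Bh; split; last exact: sub.
by have [g [Bg hg gh]] := vertex_stab_inv Bh; move=> /(sub _ _ Bg); rewrite hg.
Qed.

(** On each edge of [O] the map is replaced by the affine one with the same image edge and the same
    effect on the end points. Affine maps respect symmetric levels, which [h] need not do. *)
Lemma vertex_stab_straighten h : vertex_stab h ->
  exists u, [/\ vertex_stab u, forall x, ~ edge_point O x -> u x = h x
    & forall i, O i -> exists j b, O j /\ forall t : R, 0 < t < 1 ->
       u (phi i t) = phi j (flip b t) /\
       exists2 r : R, 0 < r < 1 & h (phi i t) = phi j r].
Proof.
move=> Bh; have [h' [Bh' hK h'K]] := vertex_stab_inv Bh.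
have [s hs] := edge_perm Bh; have [s' hs'] := edge_perm Bh'.
have sK := edge_permK hK hs hs'; have s'K := edge_permK h'K hs' hs.
have /choice[b bP] := endpoints Bh Bh' hK h'K hs hs'.
have Os i : O (s i) <-> O i.
  by split; [move/(edge_orbitP Bh' hs'); rewrite sK|exact: (edge_orbitP Bh hs)].
have b' i : h' (phi i 0) = phi (s' i) (flip (b (s' i)) 0) /\
            h' (phi i 1) = phi (s' i) (flip (b (s' i)) 1).
  have [] := bP (s' i); rewrite s'K; case: (b (s' i)); rewrite /flip ?subr0 ?subrr => <- <-.
    by rewrite !hK.
  by rewrite !hK.
have [i|i|i|i|i|i|i _|i _|i _|i _|u [uh uN uO]] := @glue_homeo O h h' s s' (fun i => flip (b i)) (fun i => flip (b (s' i)))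
   Bh.1.1 Bh'.1.1 hK h'K sK s'K Os (fun x => edge_orbit_stab x Bh).
- exact: flip_continuous.
- exact: flip_continuous.
- exact: flip01.
- exact: flip01.
- by rewrite sK; exact: flipK.
- exact: flipK.
- by case: (bP i).
- by case: (bP i).
- by case: (b' i).
- by case: (b' i).
exists u; split=> //.
  split=> //; apply: (vertex_fix Bh _ uN uO); last by move=> i; exact: flip01.
  by move=> x; exact: edge_orbit_stab.
move=> i Oi; exists (s i), (b i); split; first exact/Os.
by move=> t t01; split; [apply: uO => //; exact: oc|exact: hs].
Qed.

End Stabilizer.

(** * Chains and the group preserving the levels *)

Section Chains.
Variables (X : topologicalType) (G : set (X -> X)).
Implicit Types (Y : set X).

(** Leaving the top member free allows induction by removing it. *)
Definition chain_to (n : nat) Y := exists Z : nat -> set X,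
    (forall i, (i <= n)%N -> closed (Z i) /\ G_invariant G (Z i)) /\
    (forall i, (i < n)%N -> Z i `<` Z i.+1) /\ Z n = Y.

Lemma chain_to0 Y : closed Y -> G_invariant G Y -> chain_to 0 Y.
Proof. by move=> cY iY; exists (fun=> Y); split. Qed.

Lemma chain_to_closed n Y : chain_to n Y -> closed Y /\ G_invariant G Y.
Proof. by move=> [Z [cZ [_ <-]]]; exact: cZ. Qed.

Lemma chain_toS n Y Y' : chain_to n Y -> closed Y' -> G_invariant G Y' -> Y `<` Y' ->
  chain_to n.+1 Y'.
Proof.
move=> [Z [cZ [sZ <-]]] cY iY YY'; exists (fun i => if (i <= n)%N then Z i else Y').
split; first by move=> i _; case: ifP => // /cZ.
split; last by rewrite ltnn.
move=> i; rewrite ltnS => i_n; rewrite i_n; case: ifP => [/sZ //|].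
by rewrite leq_eqVlt in i_n; case/orP: i_n => [/eqP -> //|->].
Qed.

Lemma chain_to_pred n Y : chain_to n.+1 Y -> exists2 Y', chain_to n Y' & Y' `<` Y.
Proof.
move=> [Z [cZ [sZ <-]]]; exists (Z n); last exact: sZ.
exists Z; split; first by move=> i i_n; apply: cZ; exact: leqW.
by split=> // i i_n; apply: sZ; exact: leqW.
Qed.

Lemma chain_mono n (Z : nat -> set X) : (forall i, (i < n)%N -> Z i `<` Z i.+1) ->
  forall i j, (i <= j <= n)%N -> Z i `<=` Z j.
Proof.
move=> sZ i j /andP[]; elim: j => [|j IH]; first by rewrite leqn0 => /eqP -> _; exact: subset_refl.
rewrite leq_eqVlt => /orP[/eqP -> _|ij jn]; first exact: subset_refl.
apply: subset_trans (properW (sZ _ jn)).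
by apply: IH => //; exact: ltnW.
Qed.

(** Each colour class lies in one orbit. Choosing in every member of the chain a point absent from
    the previous member gives points of distinct colours, since an invariant set containing a point
    contains its whole class. *)
Lemma chain_bound (C : finType) (c : X -> C) :
  (forall x y, c x = c y -> exists2 g, G g & g x = y) ->
  forall n, has_chain G n -> (n < #|C|)%N.
Proof.
move=> tr n [Z [cZ [sZ _]]].
have /choice[y yP] : forall i : 'I_n.+1, exists y, Z i y /\ ((0 < i)%N -> ~ Z i.-1 y).
  move=> [[|i] /=]; rewrite ltnS => i_n.
    by have [_ [[y Zy] _]] := cZ 0%N i_n; exists y.
  by have [_ /nonsubset[y [? ?]]] := sZ i i_n; exists y.
suff inj : injective (c \o y) by rewrite -[n.+1]card_ord; exact: leq_card inj.
suff lt (i j : 'I_n.+1) : (i < j)%N -> c (y i) <> c (y j).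
  move=> i j /= cij; apply/val_inj; case: (ltngtP i j) => // ij.
    by case: (lt _ _ ij).
  by case: (lt _ _ ij).
move=> ij /tr[g Gg gij]; have [_] := yP j; apply; first exact: leq_trans ij.
have j_n : (j.-1 <= n)%N by have := ltn_ord j; lia.
rewrite -gij; have [_ [_ inv]] := cZ _ j_n; apply: inv => //.
have [+ _] := yP i; apply: (chain_mono sZ).
by rewrite j_n andbT; lia.
Qed.

End Chains.

Lemma has_chain_sub (X : topologicalType) (G H : set (X -> X)) n :
  G `<=` H -> has_chain H n -> has_chain G n.
Proof.
move=> GH [Z [cZ sZ]]; exists Z; split=> // i /cZ[? [? iZ]]; split=> //; split=> //.
by move=> g y /GH; exact: iZ.
Qed.

(** * Orbits and chains of the group preserving the levels *)

Section LevelGroup.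
Variables (R : realType) (X : topologicalType).
Hypothesis Xh : hausdorff_space X.
Variables (I : finType) (phi : I -> R -> X).
Hypothesis dec : edge_decomposition phi.
Variable i0 : I.

Local Notation vertex := (vertex phi).
Local Notation edge_point := (edge_point phi).
Local Notation O := (edge_orbit phi i0).
Local Notation B := (vertex_stab phi).

Let disj i j (s t : R) : 0 < s < 1 -> 0 <= t <= 1 -> phi i s = phi j t -> i = j /\ s = t.
Proof. by case: dec => _ _; apply. Qed.
Let oc (t : R) : 0 < t < 1 -> 0 <= t <= 1.
Proof. by move=> /andP[a b]; rewrite !ltW. Qed.
Let disjo i j (s t : R) : 0 < s < 1 -> 0 < t < 1 -> phi i s = phi j t -> i = j /\ s = t.
Proof. by move=> s01 t01; apply: disj => //; exact: oc. Qed.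

Definition at_level (L : R -> nat) (x : X) (n : nat) :=
  exists i (t : R), [/\ O i, 0 < t < 1, x = phi i t & L t = n].

Definition level_group (L : R -> nat) : set (X -> X) :=
  [set h | B h /\ forall x n, at_level L (h x) n <-> at_level L x n].

Lemma level_group_group L : subgroup_Homeo (level_group L).
Proof.
split; first by move=> h [[]].
split; first by split=> //; exact: vertex_stab_id.
split.
  move=> f g [Bf Lf] [Bg Lg]; split; first exact: vertex_stab_comp.
  by move=> x n; rewrite /= Lf.
move=> f [Bf Lf]; have [g [Bg fg gf]] := vertex_stab_inv Bf.
by exists g; split=> //; split=> // x n; rewrite -Lf gf.
Qed.

Section Levels.
Variables (k : nat) (L : R -> nat).
Hypothesis Lk : edge_levels k L.

Local Notation G := (level_group L).

(** One direction is enough: [u] permutes the points on the edges of [O], and each of them has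
    exactly one level. *)
Lemma level_groupI u : B u ->
  (forall i (t : R), O i -> 0 < t < 1 ->
     exists j (r : R), [/\ O j, 0 < r < 1, u (phi i t) = phi j r & L r = L t]) -> G u.
Proof.
move=> Bu uL; split=> // x n; split.
  move=> [j [r [Oj r01 uE <-]]].
  have /(edge_orbit_stab Xh dec i0 x Bu)[i [t [Oi t01 xE]]] : edge_point O (u x).
    by exists j, r.
  have [j' [r' [Oj' r01' xE' Lr']]] := uL i t Oi t01.
  by move: uE; rewrite xE xE' => /disjo[] // _ <-; exists i, t.
move=> [i [t [Oi t01 -> <-]]]; have [j [r [Oj r01 -> Lr]]] := uL i t Oi t01.
by exists j, r.
Qed.

Lemma level_flip b t : 0 < t < 1 -> L (flip b t) = L t.
Proof. by case: Lk => _ _ LN _ _; case: b => //=; exact: LN. Qed.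

Lemma level_group_straighten h : B h ->
  exists u, [/\ G u, forall x, ~ edge_point O x -> u x = h x
    & forall i, O i -> exists j b, O j /\ forall t : R, 0 < t < 1 ->
       u (phi i t) = phi j (flip b t) /\
       exists2 r : R, 0 < r < 1 & h (phi i t) = phi j r].
Proof.
move=> Bh; have [u [Bu uN uO]] := vertex_stab_straighten Xh dec i0 Bh.
exists u; split=> //; apply: level_groupI => // i t Oi t01.
have [j [b [Oj uj]]] := uO i Oi; have [-> _] := uj t t01.
by exists j, (flip b t); split=> //; [exact: flip01|exact: level_flip].
Qed.

(** Consequently the level group and the vertex stabilizer have the same orbits outside the open
    edges of [O]. *)
Lemma level_group_outside h : B h ->
  exists2 g, G g & forall x, ~ edge_point O x -> g x = h x.
Proof. by move=> /level_group_straighten[u [Gu uN _]]; exists u. Qed.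

(** An element of the stabilizer carries the edge [i] to [j] by way of [i0]. Straightening it makes
    it preserve levels, and a shift along the edges of [O] then moves [flip b s] to [t]. *)
Lemma level_group_trans i j s t : O i -> O j -> 0 < s < 1 -> 0 < t < 1 -> L s = L t ->
  exists2 g, G g & g (phi i s) = phi j t.
Proof.
move=> Oi Oj s01 t01 Lst.
have [hi [ri [Bi ri01 hiE]]] := Oi; have [hj [rj [Bj rj01 hjE]]] := Oj.
have [hi' [Bi' hiK _]] := vertex_stab_inv Bi.
have [u [Gu _ uO]] := level_group_straighten (vertex_stab_comp Bj Bi').
have [j' [b [Oj' uj]]] := uO i Oi.
have [_ [r r01 /=]] := uj ri ri01.
rewrite -hiE hiK hjE => /disjo[] // jj _; subst j'.
have fs := @flip01 _ b _ s01.
have [_ _ _ _ Ltr] := Lk.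
have [|g [g' [og gs g0 g1 gL]]] := Ltr (flip b s) t fs t01; first by rewrite level_flip.
have [w [Bw _ wO]] := @vertex_stab_shift _ _ Xh _ _ dec O _ _ og g0 g1.
have [gK g'K gi g'i] := og.
have Gw : G w.
  apply: level_groupI => // l q Ol q01; exists l, (g q); split=> //.
  - by case/andP: q01 => q0 q1; rewrite -g0 -g1 !gi.
  - by apply: wO => //; exact: oc.
  - exact: gL.
exists (w \o u); first by case: (level_group_group L) => _ [_ [+ _]]; exact.
by have [/= -> _] := uj s s01; rewrite wO ?gs //; exact: oc.
Qed.

(** The complement consists of the points of level above [j], which form an open subset of each open
    edge of [O]. *)
Lemma closed_levels j : closed (~` edge_point O `|`
   [set x | exists2 n, (n <= j)%N & at_level L x n]).
Proof.
rewrite -[X in closed X]setCK; apply: open_closedC.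
have -> : ~` (~` edge_point O `|` [set x | exists2 n, (n <= j)%N & at_level L x n]) =
   \bigcup_(i in O) phi i @` [set t : R | 0 < t < 1 /\ (j < L t)%N].
  apply/seteqP; split=> x.
    rewrite setCU setCK => -[[i [t [Oi t01 xE]]] nx]; exists i => //; exists t => //.
    split=> //; rewrite ltnNge; apply/negP => Lj; apply: nx; exists (L t) => //.
    by exists i, t.
  move=> [i Oi [t [t01 jL] <-]] [|[n nj]]; first by apply; exists i, t.
  by move=> [i' [t' [_ t01' /disjo[] // _ <- Ln]]]; move: jL; rewrite Ln ltnNge nj.
apply: bigcup_open => i _; apply: edge_open => //; last by move=> t [].
rewrite openE => t [t01 jL]; have [_ _ _ Lo _] := Lk.
have [a [b [/andP[at_ tb] ab]]] := Lo j t t01 jL.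
rewrite /interior; near=> s; apply: ab; apply/andP; split; near: s.
  exact: lt_nbhsr.
exact: lt_nbhsl.
Unshelve. all: by end_near.
Qed.

Let at_level_exists x : edge_point O x -> exists2 n, (n <= k)%N & at_level L x n.
Proof. by move=> [i [t [Oi t01 ->]]]; case: Lk => Le _ _ _ _; exists (L t) => //; exists i, t. Qed.

Let level_full Y x n y : G_invariant G Y -> at_level L x n -> at_level L y n -> Y x -> Y y.
Proof.
move=> [_ iY] [i [s [Oi s01 -> <-]]] [j [t [Oj t01 -> Lt]]] Yx.
by have [g Gg <-] := level_group_trans Oi Oj s01 t01 (esym Lt); exact: iY.
Qed.

(** Such a set contains an entire level, and this level accumulates at both ends of every edge of
    [O]. *)
Lemma invariant_ends Y : closed Y -> G_invariant G Y -> Y `&` edge_point O !=set0 ->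
  forall i (t : R), O i -> 0 <= t <= 1 -> ~ (0 < t < 1) -> Y (phi i t).
Proof.
move=> cY iY [x [Yx /at_level_exists[n nk xn]]] i t Oi t01 nt.
have te : t = flip (t == 1) 0.
  case: eqP => [->|/eqP t1]; rewrite /flip ?subr0 //.
  case/andP: t01; rewrite le_eqVlt => /orP[/eqP <- //|t0]; rewrite le_eqVlt (negPf t1) /= => t1'.
  by case: nt; rewrite t0.
apply: (@preimage_limit _ _ (phi i)) => //; first by case: dec => c _ _; exact: c.
move=> e e0; case: Lk => _ Lj _ _ _.
have [r [r01 re Lr]] := Lj n nk e e0; have /andP[r0 r1] := r01.
exists (flip (t == 1) r).
  by rewrite {1}te; case: (t == 1); rewrite /= ?sub0r ?normrN ?subr0 ?subKr gtr0_norm.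
apply: (level_full iY xn _ Yx); exists i, (flip (t == 1) r).
by split=> //; [exact: flip01|rewrite level_flip].
Qed.

(* The [B]-saturation of a [G]-invariant set. *)
Let star (Y : set X) : set X :=
  Y `|` [set x | Y `&` edge_point O !=set0 /\ edge_point O x].

(** By [invariant_ends] it makes no difference whether open or closed edges of [O] are added. *)
Let star_closed Y : closed Y -> G_invariant G Y -> closed (star Y).
Proof.
move=> cY iY; have [ne|ne] := pselect (Y `&` edge_point O !=set0); last first.
  by have -> : star Y = Y; [apply/seteqP; split=> x; [case=> [//|[]]|left]|].
have -> : star Y = Y `|` \bigcup_(i in O) phi i @` [set t : R | 0 <= t <= 1].
  apply/seteqP; split=> x [Yx|]; first by left.
  - by move=> [_ [i [t [Oi t01 ->]]]]; right; exists i => //; exists t => //; exact: oc.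
  - by left.
  - move=> [i Oi [t t01 <-]]; have [t01'|nt] := pselect (0 < t < 1).
      by right; split=> //; exists i, t.
    by left; exact: invariant_ends.
by apply: closedU => //; apply: finite_closed_bigcup => i _; exact: edge_closed.
Qed.

Let star_inv Y : G_invariant G Y -> G_invariant B (star Y).
Proof.
move=> iY; split; first by case: iY => -[y Yy] _; exists y; left.
move=> h y Bh sY; have [Oy|Oy] := pselect (edge_point O y).
  right; split; last exact/edge_orbit_stab.
  by case: sY => [Yy|[]//]; exists y.
left; have [g Gg gE] := level_group_outside Bh; rewrite -gE //.
by case: iY => _; apply=> //; case: sY => [|[]].
Qed.

Let star_sub Y Y' : Y `<=` Y' -> star Y `<=` star Y'.
Proof.
move=> YY x [/YY Yx|[[z [/YY Yz Oz]] Ox]]; first by left.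
by right; split=> //; exists z.
Qed.

Let nlev (Y : set X) := #|[set j : 'I_k.+1 | `[<exists2 x, Y x & at_level L x j>]]|%SET.

Let nlev_gt0 Y : Y `&` edge_point O !=set0 -> (0 < nlev Y)%N.
Proof.
move=> [x [Yx /at_level_exists[n nk xn]]]; apply/card_gt0P; rewrite -ltnS in nk.
by exists (Ordinal nk); rewrite !inE; exists x.
Qed.

Let nlev_sub Y Y' : Y `<=` Y' -> (nlev Y <= nlev Y')%N.
Proof.
move=> YY; apply/subset_leq_card/fintype.subsetP => j; rewrite !inE => -[x /YY Yx xj].
by exists x.
Qed.

Let nlev_proper Y Y' x : G_invariant G Y -> Y `<=` Y' -> Y' x -> ~ Y x -> edge_point O x ->
  (nlev Y < nlev Y')%N.
Proof.
move=> iY YY Yx' Yx /at_level_exists[n nk xn]; rewrite -ltnS in nk.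
apply/proper_card/fintype.properP; split.
  apply/fintype.subsetP => j; rewrite !inE => -[z /YY Yz zj].
  by exists z.
exists (Ordinal nk); rewrite ?inE; first by exists x.
by apply/negP; rewrite !inE => -[z Yz zn]; apply: Yx; exact: level_full iY zn xn Yz.
Qed.

(** A step of the chain either enlarges the saturation, which gives a step for [B], or adds a new
    level inside [O]. A step that first meets [O] is of the former kind, so the latter kind occurs
    at most [(nlev Y).-1] times. *)
Let star_chain n Y : chain_to G n Y ->
  exists2 m, chain_to B m (star Y) & (n <= m + (nlev Y).-1)%N.
Proof.
elim: n Y => [|n IH] Y cY; have [clY iY] := chain_to_closed cY.
  by exists 0%N => //; apply: chain_to0; [exact: star_closed|exact: star_inv].
have [Y' cY' [sYY' nYY']] := chain_to_pred cY; have [clY' iY'] := chain_to_closed cY'.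
have [m cm nm] := IH _ cY'.
have [E|nE] := pselect (star Y' = star Y).
  exists m; first by rewrite -E.
  have [x [Yx nYx]] : exists x, Y x /\ ~ Y' x by move/nonsubset: nYY' => [x []]; exists x.
  have : star Y' x by rewrite E; left.
  case=> // -[ne Ox]; have := nlev_proper iY' sYY' Yx nYx Ox.
  have := nlev_gt0 ne; lia.
exists m.+1.
  apply: chain_toS cm _ _ _; [exact: star_closed|exact: star_inv|].
  by split; [exact: star_sub|move=> h; apply: nE; apply/seteqP; split=> //; exact: star_sub].
have := nlev_sub sYY'; lia.
Qed.

Lemma level_group_chain_le n : has_chain G n -> exists2 m, has_chain B m & (n <= m + k)%N.
Proof.
move=> /star_chain[m cm nm].
have sT : star setT = setT by apply/seteqP; split=> // x _; left.
rewrite sT in cm; exists m => //.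
apply: (leq_trans nm); rewrite leq_add2l.
have : (nlev setT <= k.+1)%N by rewrite -[X in (_ <= X)%N]card_ord; exact: max_card.
lia.
Qed.

End Levels.

(** With [k = 0] there is a single level, and [level_group_trans] becomes transitivity. *)
Lemma edge_orbit_trans x y : edge_point O x -> edge_point O y -> exists2 h, B h & h x = y.
Proof.
have [L L0] := @exists_edge_levels R 0.
move=> [i [s [Oi s01 ->]]] [j [t [Oj t01 ->]]].
have [|g [Bg _] gE] := level_group_trans L0 Oi Oj s01 t01; last by exists g.
by case: L0 => Le _ _ _ _; apply/eqP; rewrite eq_sym; have := Le s; have := Le t; rewrite !leqn0 => /eqP -> /eqP ->.
Qed.

(** Let [Z m] be the first member meeting [O]; it and all later members contain all of [O].
    Replacing [Z m] by its intersections with [D 0], ..., [D k] adds [k] steps. *)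
Lemma level_group_chain_ge k L n : edge_levels k L -> has_chain B n ->
  has_chain (level_group L) (n + k).
Proof.
move=> Lk [Z [cZ [sZ Zn]]].
pose meets i := `[<Z i `&` edge_point O !=set0>].
have half : 0 < (1 / 2 : R) < 1 by apply/andP; split; lra.
have Oh : edge_point O (phi i0 (1 / 2)).
  by exists i0, (1 / 2); split=> //; exact: edge_orbit_id.
have mn : exists i, meets i by exists n; apply/asboolP; rewrite Zn; exists (phi i0 (1 / 2)).
have [m /asboolP mm mmin] := ex_minnP mn.
have m_n : (m <= n)%N.
  by apply: mmin; apply/asboolP; rewrite Zn; exists (phi i0 (1 / 2)).
pose D j := ~` edge_point O `|` [set x | exists2 l, (l <= j)%N & at_level L x l].
have DS j : D j `<=` D j.+1.
  by move=> x [nx|[l lj xl]]; [left|right; exists l => //; exact: leqW].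
have Dk : D k = setT.
  apply/seteqP; split=> // x _; have [[i [t [Oi t01 xE]]]|] := pselect (edge_point O x); last by left.
  by right; exists (L t); [case: Lk|exists i, t].
have cD j : closed (D j) by exact: closed_levels Lk j.
have below i : (i < m)%N -> Z i `<=` ~` edge_point O.
  move=> im x Zx Ox; suff : (m <= i)%N by rewrite leqNgt im.
  by apply: mmin; apply/asboolP; exists x.
have above i x : (m <= i <= n)%N -> edge_point O x -> Z i x.
  move=> /andP[mi i_n] Ox; apply: (chain_mono sZ (i := m)); first by rewrite mi.
  have [z [Zz Oz]] := mm; have [h Bh <-] := edge_orbit_trans Oz Ox.
  by have [_ [_ iZ]] := cZ m m_n; exact: iZ.
have lev j : (j <= k)%N -> exists2 x, edge_point O x & at_level L x j.
  case: Lk => _ Lj _ _ _ /Lj /(_ 1 ltr01)[t [t01 _ Lt]].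
  have Oi := edge_orbit_id phi i0.
  by exists (phi i0 t); exists i0, t.
(* The new chain follows [Z] up to index [m], stays at [Z m] while the level bound grows from 0 to
   [k], then follows [Z] again with indices shifted by [k]. *)
pose b p := minn (p - m) k.
exists (fun p => Z (p - b p)%N `&` D (b p)); split; last split.
- move=> p pn; have [cl [_ iZ]] := cZ (p - b p)%N ltac:(rewrite /b; lia).
  split; first exact: closedI.
  split.
    case: (ltnP p m) => pm.
      have [_ [[z Zz] _]] := cZ p ltac:(lia).
      have -> : b p = 0%N by rewrite /b; lia.
      by rewrite subn0; exists z; split=> //; left; exact: below Zz.
    have [x Ox xb] := lev (b p) ltac:(rewrite /b; lia).
    exists x; split; last by right; exists (b p).
    by apply: above => //; rewrite /b; lia.
  move=> g y [Bg gL] [Zy Dy]; split; first exact: iZ.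
  case: Dy => [ny|[l lb yl]]; first by left=> /(edge_orbit_stab Xh dec i0 y Bg).
  by right; exists l => //; apply/gL.
- move=> p pn; case: (ltnP p m) => pm; last case: (ltnP p (m + k)) => pk.
  + have [-> ->] : b p = 0%N /\ b p.+1 = 0%N by rewrite /b; lia.
    rewrite !subn0; have [s1 /nonsubset[x [Zx nZx]]] := sZ p ltac:(lia).
    split; first by move=> y [/s1 ? ?].
    case: (ltnP p.+1 m) => pm' sub.
      by case: (sub x) => //; split=> //; left; exact: below Zx.
    (* Here [p.+1 = m]: intersecting with [D 0] may discard the new point [x], so a point of level 0
       in [O] witnesses strictness. *)
    have [z Oz z0] := lev 0%N (leq0n _).
    case: (sub z) => [|Zz _]; last exact: (below p) Zz Oz.
    by split; [apply: above => //; lia|right; exists 0%N].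
  + have -> : b p.+1 = (b p).+1 by rewrite /b; lia.
    have -> : (p.+1 - (b p).+1 = p - b p)%N by lia.
    split; first by move=> y [? /DS ?].
    have [x Ox xb] := lev (b p).+1 ltac:(rewrite /b; lia).
    move=> /(_ x)[]; first split.
    * by apply: above => //; rewrite /b; lia.
    * by right; exists (b p).+1.
    move=> _ [//|[l lb [i [t [_ t01 xE Lt]]]]].
    case: xb => [j [s [_ s01 xE' Ls]]]; move: xE; rewrite xE' => /disjo[] // _ st.
    by move: lb; rewrite -Lt -st Ls ltnn.
  + have [-> ->] : b p = k /\ b p.+1 = k by rewrite /b; lia.
    rewrite Dk !setIT subSn; last by lia.
    by apply: sZ; lia.
- have -> : b (n + k)%N = k by rewrite /b; lia.
  by rewrite Dk setIT addnK.
Qed.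

End LevelGroup.

(** * Merging edges *)

Section Ends.
Variables (R : realType) (X : topologicalType).
Hypothesis Xh : hausdorff_space X.
Variables (I : finType) (phi : I -> R -> X).
Hypothesis dec : edge_decomposition phi.

Local Notation vertex := (vertex phi).

Let phic i : continuous (phi i). Proof. by case: dec. Qed.
Let cover x : exists i (t : R), 0 <= t <= 1 /\ x = phi i t. Proof. by case: dec. Qed.
Let disj i j (s t : R) : 0 < s < 1 -> 0 <= t <= 1 -> phi i s = phi j t -> i = j /\ s = t.
Proof. by case: dec => _ _; apply. Qed.
Let oc (t : R) : 0 < t < 1 -> 0 <= t <= 1.
Proof. by move=> /andP[a b]; rewrite !ltW. Qed.
Let phifc j b : continuous (fun t : R => phi j (flip b t)).
Proof. by move=> t; apply: continuous_comp; [exact: flip_continuous|exact: phic]. Qed.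

(** An open arc of [X] through [c t0]. It will be the image of an open edge under a homeomorphism
    that brings one of its points to a vertex. *)
Definition chart (c : R -> X) (t0 : R) :=
  [/\ continuous c, 0 < t0 < 1,
      forall s t : R, 0 < s < 1 -> 0 < t < 1 -> c s = c t -> s = t
    & forall U : set R, open U -> U `<=` [set t : R | 0 < t < 1] -> open (c @` U)].

(* The end of the edge [j] at its end point [phi j (flip b 0)] is encoded by [(j, b)];
   it is a right end if it starts on the side [s > t0] of the chart [c]. *)
Definition right_end (c : R -> X) (t0 : R) (j : I) (b : bool) :=
  exists2 e : R, 0 < e < 1 / 2 & forall r : R, 0 < r <= e ->
    exists2 s : R, t0 < s < 1 & phi j (flip b r) = c s.

(** Left ends are right ends of the reversed chart, so only one side has to be studied. *)
Lemma chart_flip c t0 : chart c t0 -> chart (c \o flip true) (flip true t0).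
Proof.
move=> [cc t01 ci co]; split.
- by move=> t; apply: continuous_comp; [exact: flip_continuous|exact: cc].
- exact: flip01.
- move=> s t s01 t01' /= /ci E; have := E (flip01 true s01) (flip01 true t01').
  by move/(can_inj (flipK true)).
- move=> U oU U01; have -> : (c \o flip true) @` U = c @` (flip true @^-1` U).
    apply/seteqP; split=> x [t Ut <-]; exists (flip true t) => //.
      by rewrite /preimage /mkset flipK.
    by rewrite /comp flipK.
  apply: co; first by move/continuousP: (@flip_continuous R true); exact.
  by move=> t /U01 /=; lra.
Qed.

Lemma chart_homeo h h' i t0 : continuous h -> continuous h' -> cancel h h' -> cancel h' h ->
  0 < t0 < 1 -> chart (h' \o phi i) t0.
Proof.
move=> hc h'c hK h'K t01; split=> //.
- by move=> t; apply: continuous_comp; [exact: phic|exact: h'c].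
- by move=> s t s01 /oc t01' /= /(can_inj h'K) /disj[].
- move=> U oU U01; have -> : (h' \o phi i) @` U = h @^-1` (phi i @` U).
    apply/seteqP; split=> [_ [t Ut <-]|x [t Ut hx]]; exists t => //=.
    by rewrite hx.
  by move/continuousP: hc; apply; exact: edge_open.
Qed.

(** * The edge ends at a vertex that lies inside a chart *)

Section Chart.
Variables (c : R -> X) (t0 : R).
Hypotheses (ch : chart c t0) (cv : vertex (c t0)).

Lemma chart_near (a b : R) j d : 0 <= a -> b <= 1 -> a < t0 < b -> phi j (flip d 0) = c t0 ->
  exists2 e : R, 0 < e < 1 / 2 & forall r : R, 0 < r <= e ->
    exists2 s : R, a < s < b & phi j (flip d r) = c s.
Proof.
have [cc t01 ci co] := ch => a0 b1 atb E.
have oab : open (c @` [set s : R | a < s < b]).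
  apply: co; last by move=> s /= /andP[? ?]; apply/andP; split; lra.
  by have := @itv_open _ R a b; congr open; apply/seteqP; split=> x /=; rewrite in_itv.
have : nbhs (phi j (flip d 0)) (c @` [set s : R | a < s < b]).
  by rewrite E; apply: open_nbhs_nbhs; split=> //; exists t0.
move=> /(@phifc j d 0) /nbhs_ballP[e /= e0 he].
exists (Num.min (e / 2) (1 / 4)); first by rewrite lt_min gt_min; lra.
move=> r; rewrite le_min => /and3P[r0 re _]; have [|s sab sE] := he r.
  by rewrite /ball /= sub0r normrN gtr0_norm //; lra.
by exists s.
Qed.

Lemma chart_itv_open (a b : R) : 0 <= a -> b <= 1 -> open (c @` [set s : R | a < s < b]).
Proof.
have [cc t01 ci co] := ch => a0 b1.
apply: co; last by move=> s /= /andP[? ?]; apply/andP; split; lra.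
by have := @itv_open _ R a b; congr open; apply/seteqP; split=> x /=; rewrite in_itv.
Qed.

Lemma half_edge_connected j d (e : R) :
  connected ((fun t => phi j (flip d t)) @` [set r : R | 0 < r <= e]).
Proof.
apply: connected_continuous_connected; last exact/continuous_subspaceT/phifc.
apply/connected_intervalP => x y /= /andP[x0 _] /andP[_ ye] z /andP[xz zy].
by rewrite (lt_le_trans x0 xz) (le_trans zy ye).
Qed.

(** A short initial piece of the edge lies in the chart and avoids the vertex [c t0]; being
    connected, it stays on one side. *)
Lemma end_left_or_right j d : phi j (flip d 0) = c t0 ->
  right_end c t0 j d \/ right_end (c \o flip true) (flip true t0) j d.
Proof.
have [cc t01 ci co] := ch; move=> E.
have [e e12 he] := chart_near (lexx 0) (lexx 1) t01 E.
have e0 : 0 < e <= e by rewrite lexx andbT; case/andP: e12.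
pose A := (fun t => phi j (flip d t)) @` [set r : R | 0 < r <= e].
have side (r : R) : 0 < r <= e -> exists2 s : R, (t0 < s < 1) || (0 < s < t0) & phi j (flip d r) = c s.
  move=> re; have [s s01 sE] := he r re; exists s => //.
  have : s != t0.
    apply/eqP => st; apply: (@edge_nvertex _ _ _ _ dec j (flip d r)).
      by apply: flip01; lra.
    by rewrite sE st.
  by case: (ltgtP s t0) => // _ _; rewrite ?orbF ?orbT; case/andP: s01 => -> ->; rewrite ?orbT.
have cov : A `<=` c @` [set s : R | t0 < s < 1] `|` c @` [set s : R | 0 < s < t0].
  move=> _ [r /side[s /orP[ss|ss] ->] <-]; [left|right]; by exists s.
have dj : (c @` [set s : R | t0 < s < 1]) `&` (c @` [set s : R | 0 < s < t0]) = set0.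
  apply/seteqP; split=> // _ [[s /= s1 <-] [s' /= s'1 ss']].
  by have := ci s' s ltac:(lra) ltac:(lra) ss'; lra.
have o1 : open (c @` [set s : R | t0 < s < 1]) by apply: chart_itv_open => //; lra.
have o2 : open (c @` [set s : R | 0 < s < t0]) by apply: chart_itv_open => //; lra.
have Ac : connected A by exact: half_edge_connected.
have Ae : A (phi j (flip d e)) by exists e.
have [s /orP[ss|ss] sE] := side e e0; [left|right]; exists e => // r re.
  have sub : A `<=` c @` [set s : R | t0 < s < 1].
    apply: (connected_sub_open Ac o1 o2) => //.
      by rewrite -setIA dj setI0.
    by exists (phi j (flip d e)); split=> //; exists s.
  by have [|s' s'1 <-] := sub (phi j (flip d r)); [exists r|exists s'].
have sub : A `<=` c @` [set s : R | 0 < s < t0].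
  apply: (connected_sub_open Ac o2 o1) => //.
  - by rewrite setUC.
  - by rewrite -setIA setIC (setIC (c @` _)) dj set0I.
  - by exists (phi j (flip d e)); split=> //; exists s.
have [|s' s'1 <-] := sub (phi j (flip d r)); first by exists r.
exists (flip true s'); first by rewrite /flip; move: s'1 => /=; lra.
by rewrite /= opprB addrC subrK.
Qed.

(** If [c s] were missed, the connected half edge, which reaches [c s1] beyond [c s], would lie
    entirely beyond it and could not tend to [c t0]. *)
Lemma right_end_fills j d : phi j (flip d 0) = c t0 -> right_end c t0 j d ->
  exists2 s1 : R, t0 < s1 < 1 & forall s : R, t0 < s < s1 ->
    exists2 r : R, 0 < r < 1 / 2 & phi j (flip d r) = c s.
Proof.
have [cc t01 ci co] := ch; move=> E [e e12 he].
have e0 : 0 < e <= e by rewrite lexx andbT; case/andP: e12.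
have [s1 s11 s1E] := he e e0; exists s1 => // s ss1.
apply: contrapT => nr.
pose A := (fun t => phi j (flip d t)) @` [set r : R | 0 < r <= e].
have sub : A `<=` c @` [set s' : R | s < s' < 1].
  apply: (@connected_sub_open _ _ _ (c @` [set s' : R | t0 < s' < s])).
  - exact: half_edge_connected.
  - by apply: chart_itv_open; lra.
  - by apply: chart_itv_open; lra.
  - move=> _ [r /= re <-]; have [s' s'1 s'E] := he r re.
    case: (ltgtP s' s) => ss'.
    + by right; exists s' => //=; lra.
    + by left; exists s' => //=; lra.
    + by case: nr; exists r; [lra|rewrite s'E ss'].
  - apply/seteqP; split=> // _ [[_ [s' /= s'1 <-]] [s2 /= s21 ss2]].
    by have := ci s2 s' ltac:(lra) ltac:(lra) ss2; lra.
  - by exists (phi j (flip d e)); split; [exists e|exists s1 => //=; lra].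
have [e' e'12 he'] := @chart_near 0 s j d (lexx 0) ltac:(lra) ltac:(lra) E.
pose r := Num.min e e'.
have r0 : 0 < r by rewrite lt_min; lra.
have [re re'] : r <= e /\ r <= e' by rewrite !ge_min !lexx orbT.
have [s' s'1 s'E] := he' r ltac:(lra).
have [|s2 /= s21] := sub (phi j (flip d r)); first by exists r => //=; lra.
by rewrite s'E => /ci; lra.
Qed.

(** Otherwise all ends at [c t0] are left ends. Cutting a short piece off each of them leaves
    finitely many closed pieces that cover the right side of the chart, hence also its limit [c t0],
    although [c t0] was cut off. *)
Lemma exists_right_end : exists j d, phi j (flip d 0) = c t0 /\ right_end c t0 j d.
Proof.
have [cc t01 ci co] := ch; apply: contrapT => nl.
have /choice[e eP] : forall jd : I * bool, exists e : R, [/\ 0 <= e,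
    phi jd.1 (flip jd.2 0) = c t0 -> 0 < e, 0 < e -> phi jd.1 (flip jd.2 0) = c t0
  & forall r : R, 0 < r < e -> exists2 s : R, 0 < s < t0 & phi jd.1 (flip jd.2 r) = c s].
  move=> [j d] /=; have [E|nE] := pselect (phi j (flip d 0) = c t0); last first.
    (* Nothing is cut off at an end located elsewhere. *)
    by exists 0; split=> // [|r]; rewrite ?ltxx //; lra.
  case: (end_left_or_right E) => [l|[e e12 he]]; first by case: nl; exists j, d.
  exists e; split=> //; [lra|lra|move=> r re].
  have [s s1 sE] := he r ltac:(lra); exists (flip true s) => //.
  by move: s1; rewrite /flip; lra.
pose K j := [set t : R | e (j, false) <= t] `&` [set t : R | t <= 1 - e (j, true)].
have K01 j : K j `<=` [set t : R | 0 <= t <= 1].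
  move=> t [/= k1 k2]; have [h1 _ _ _] := eP (j, false); have [h2 _ _ _] := eP (j, true).
  by apply/andP; split; lra.
have [j _ [t Kt]] : (\bigcup_(j in setT) phi j @` K j) (c t0).
  apply: (@preimage_limit _ _ c _ t0) => //.
    apply: finite_closed_bigcup => j _; apply: closed01 (@K01 j) => //.
    by apply: closedI; [exact: closed_ge|exact: closed_le].
    exact: cc.
  move=> d d0; pose s := t0 + Num.min (d / 2) ((1 - t0) / 2).
  have [s1 s2 s3] : [/\ t0 < s, s < 1 & s < t0 + d].
    by rewrite /s; case: (leP (d / 2) ((1 - t0) / 2)) => h; split; lra.
  exists s; first by rewrite ltr0_norm; lra.
  have [j [t [t01' tE]]] := cover (c s); exists j => //; exists t => //.
  have avoid b : e (j, b) <= flip b t.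
    rewrite leNgt; apply/negP => te; have [e0 _ e2 e3] := eP (j, b).
    have ft : 0 <= flip b t by case: (b) => /=; lra.
    move: ft; rewrite le_eqVlt => /orP[/eqP ft|ft].
      have : c s = c t0 by rewrite -(e2 ltac:(lra)) ft (flipK b) tE.
      by move/ci; lra.
    have [s' s'1] := e3 (flip b t) ltac:(by rewrite ft te); rewrite /= flipK -tE => /ci; lra.
  by split=> /=; [exact: (avoid false)|have := avoid true => /=; lra].
have t01' := K01 _ _ Kt; case: Kt => /= k1 k2 tE.
have [_ h1 _ _] := eP (j, false); have [_ h2 _ _] := eP (j, true).
move: t01' => /andP[]; rewrite !le_eqVlt => /orP[/eqP t'|t0'].
  have /h1 : phi j (flip false 0) = c t0 by rewrite -tE -t'.
  by lra.
move=> /orP[/eqP t'|t1'].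
  have /h2 : phi j (flip true 0) = c t0 by rewrite -tE t' /= subr0.
  by lra.
by apply: (@edge_nvertex _ _ _ _ dec j t); rewrite ?t0' // tE.
Qed.

(** Both ends fill a right neighbourhood of [t0], so they share a point. This gives the same edge,
    and parameters below 1/2 give the same end of it. *)
Lemma right_end_inj j d j' d' : phi j (flip d 0) = c t0 -> phi j' (flip d' 0) = c t0 ->
  right_end c t0 j d -> right_end c t0 j' d' -> (j, d) = (j', d').
Proof.
move=> E E' l l'; have [s1 s11 h1] := right_end_fills E l; have [s2 s21 h2] := right_end_fills E' l'.
pose s := t0 + Num.min (s1 - t0) (s2 - t0) / 2.
have [a1 a2 a3] : [/\ t0 < s, s < s1 & s < s2] by rewrite /s; case: (leP (s1 - t0) (s2 - t0)) => h; split; lra.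
have [r r1 rE] := h1 s ltac:(lra); have [r' r'1] := h2 s ltac:(lra).
rewrite -rE => /disj[||-> ].
- by apply: flip01; lra.
- by apply/oc/flip01; lra.
by case: d d' {E E' l l' h1 h2 rE} => -[] //= ?; exfalso; lra.
Qed.

End Chart.

(* The two ends lie on the two sides of the chart. *)
Lemma two_ends c t0 : chart c t0 -> vertex (c t0) ->
  exists p q : I * bool, [/\ p != q, phi p.1 (flip p.2 0) = c t0, phi q.1 (flip q.2 0) = c t0
    & forall j d, phi j (flip d 0) = c t0 -> (j, d) = p \/ (j, d) = q].
Proof.
move=> ch cv; have ch' := chart_flip ch.
have ff : (c \o flip true) (flip true t0) = c t0 by rewrite /comp flipK.
have cv' : vertex ((c \o flip true) (flip true t0)) by rewrite ff.
have [j [d [E l]]] := exists_right_end ch cv.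
have [j' [d' [E' l']]] := exists_right_end ch' cv'.
exists (j, d), (j', d'); split=> //; last 2 first.
- by rewrite -ff.
- move=> k b Ek; case: (end_left_or_right ch cv Ek) => lk; [left|right].
    exact: (right_end_inj ch).
  by apply: (right_end_inj ch' _ E' lk l'); rewrite ff.
apply/eqP => -[jj dd]; subst j' d'.
case: l l' => [e e0 he] [e' e'0 he'].
(* If the two ends were equal, the point at parameter [r] would lie on both sides of the chart. *)
pose r := Num.min e e'.
have r0 : 0 < r by rewrite lt_min; lra.
have [re re'] : r <= e /\ r <= e' by rewrite !ge_min !lexx orbT.
have [s s1 sE] := he r ltac:(lra); have [s' s'1] := he' r ltac:(lra).
have [_ t01 ci _] := ch; move: s'1.
by rewrite sE /= => s'1 /ci; lra.
Qed.

(** The loop is closed, and it is the complement of the union of the other closed edges, since none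
    of these reaches [v]. Connectedness makes it all of [X]. *)
Lemma loop_edge j d v : connected [set: X] ->
  phi j (flip d 0) = v -> phi j (flip (~~ d) 0) = v ->
  (forall i b, phi i (flip b 0) = v -> i = j) -> forall i, i = j.
Proof.
move=> Xco E E' u i.
have ends (t : R) : 0 <= t <= 1 -> ~ (0 < t < 1) -> phi j t = v.
  move=> /andP[]; rewrite !le_eqVlt => /orP[/eqP <-|t0].
    by move=> _; case: (d) E E'.
  move=> /orP[/eqP ->|t1]; last by rewrite t0 t1.
  by case: (d) E E' => /=; rewrite subr0.
pose C := \bigcup_(k in [set~ j]) phi k @` [set t : R | 0 <= t <= 1].
have cC : closed C by apply: finite_closed_bigcup => k _; exact: edge_closed.
have DC : phi j @` [set t : R | 0 <= t <= 1] = ~` C.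
  apply/seteqP; split=> x.
    move=> [t t01 <-] [k kj [s s01]].
    have [t01'|nt] := pselect (0 < t < 1); first by move/esym/(disj t01' s01) => -[/esym].
    rewrite (ends t t01 nt); move: s01 => /andP[]; rewrite !le_eqVlt => /orP[/eqP s0|s0].
      by rewrite -s0 => _ kv; apply: kj; exact: (u k false).
    move=> /orP[/eqP s1|s1]; first by move=> sE; apply: kj; apply: (u k true); rewrite /= subr0 -s1.
    move=> sv; apply: (@edge_nvertex _ _ _ _ dec k s); rewrite ?s0 // sv -E.
    by exists j; case: (d); rewrite /= ?subr0; [right|left].
  move=> nC; have [k [t [t01 xE]]] := cover x.
  have [kj|kj] := pselect (k = j); first by exists t => //; rewrite xE kj.
  by case: nC; exists k => //; exists t.
have XE : phi j @` [set t : R | 0 <= t <= 1] = [set: X].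
  apply: Xco.
  - by exists (phi j 0), 0 => //=; rewrite lexx ler01.
  - by exists (~` C); [exact: closed_openC|rewrite setTI].
  - by exists (phi j @` [set t : R | 0 <= t <= 1]); [exact: edge_closed|rewrite setTI].
have : [set: X] (phi i (1 / 2)) by [].
have h : 0 < (1 / 2 : R) < 1 by apply/andP; split; lra.
by rewrite -XE => -[t t01] /esym /(disj h t01)[].
Qed.

(* The edges [j] and [l] are concatenated at their common end point [v], and the new
   edge takes the index [j]. *)
Lemma merge_edges j b l b' v : j != l -> vertex v ->
  phi j (flip b 0) = v -> phi l (flip b' 0) = v ->
  (forall i d, phi i (flip d 0) = v -> (i, d) = (j, b) \/ (i, d) = (l, b')) ->
  exists psi : {i : I | i != l} -> R -> X, edge_decomposition psi.
Proof.
move=> jl vv Ej El u.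
(* The first half runs along [j] towards [v], the second along [l] away from [v]. *)
pose m (t : R) := if t <= 1 / 2 then phi j (flip b (1 - 2 * t)) else phi l (flip b' (2 * t - 1)).
have mL (t : R) : t <= 1 / 2 -> m t = phi j (flip b (1 - 2 * t)) by rewrite /m => ->.
have mR (t : R) : 1 / 2 <= t -> m t = phi l (flip b' (2 * t - 1)).
  rewrite le_eqVlt => /orP[/eqP <-|t2]; last by rewrite /m leNgt t2.
  rewrite mL //; have -> : 1 - 2 * (1 / 2) = 0 :> R by lra.
  by have -> : 2 * (1 / 2) - 1 = 0 :> R by [lra]; rewrite Ej.
have m2 : m (1 / 2) = v.
  by rewrite mL //; have -> : 1 - 2 * (1 / 2) = 0 :> R by lra.
have half2 : [set t : R | t <= 1 / 2] `|` [set t : R | 1 / 2 <= t] = setT.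
  by apply/seteqP; split=> // t _ /=; case: (leP t (1 / 2)) => ?; [left|right; apply: ltW].
have mc : continuous m.
  apply/continuous_closedP => C cC.
  have -> : m @^-1` C =
     ([set t : R | t <= 1 / 2] `&` (fun t : R => phi j (flip b (1 - 2 * t))) @^-1` C) `|`
     ([set t : R | 1 / 2 <= t] `&` (fun t : R => phi l (flip b' (2 * t - 1))) @^-1` C).
    apply/seteqP; split=> t /=.
      have : ([set t : R | t <= 1 / 2] `|` [set t : R | 1 / 2 <= t]) t by rewrite half2.
      by case=> /= h; [rewrite mL //; left|rewrite mR //; right].
    by case=> -[h]; [rewrite mL|rewrite mR].
  have id2 : continuous (fun t : R => 2 * t).
    by move=> t; apply: cvgM; [exact: cvg_cst|exact: cvg_id].
  apply: closedU; apply: closedI; [exact: closed_le| |exact: closed_ge|].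
    have /continuous_closedP : continuous (fun t : R => phi j (flip b (1 - 2 * t))); last exact.
    move=> t; apply: (@continuous_comp _ _ _ (fun t : R => 1 - 2 * t) (fun t : R => phi j (flip b t))).
      by apply: cvgB; [exact: cvg_cst|exact: id2].
    exact: phifc.
  have /continuous_closedP : continuous (fun t : R => phi l (flip b' (2 * t - 1))); last exact.
  move=> t; apply: (@continuous_comp _ _ _ (fun t : R => 2 * t - 1) (fun t : R => phi l (flip b' t))).
    by apply: cvgB; [exact: id2|exact: cvg_cst].
  exact: phifc.
have fl01 d (t : R) : 0 <= t <= 1 -> 0 <= flip d t <= 1.
  by case: d => //= /andP[? ?]; apply/andP; split; lra.
have mcov (t : R) : 0 <= t <= 1 -> exists k (q : R), [/\ k = j \/ k = l, 0 <= q <= 1 & m t = phi k q].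
  move=> t01; case: (leP t (1 / 2)) => th.
    by exists j, (flip b (1 - 2 * t)); rewrite mL //; split=> //; [left|apply: fl01; lra].
  exists l, (flip b' (2 * t - 1)); rewrite mR //; last exact: ltW.
  by split=> //; [right|apply: fl01; lra].
have injm (s t : R) : 0 < s < 1 -> 0 <= t <= 1 -> m s = m t -> s = t.
  move=> s01 t01; case: (ltgtP s (1 / 2)) => sh.
  - rewrite mL ?ltW //; case: (leP t (1 / 2)) => th.
      rewrite mL // => /disj[||_ /(can_inj (flipK b))]; [by apply: flip01; lra|by apply: fl01; lra|lra].
    rewrite mR ?ltW // => /disj[||jl' _]; [by apply: flip01; lra|by apply: fl01; lra|].
    by rewrite jl' eqxx in jl.
  - rewrite mR ?ltW //; case: (leP t (1 / 2)) => th.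
      rewrite mL // => /disj[||jl' _]; [by apply: flip01; lra|by apply: fl01; lra|].
      by rewrite jl' eqxx in jl.
    by rewrite mR ?ltW // => /disj[||_ /(can_inj (flipK b'))]; [apply: flip01; lra|apply: fl01; lra|lra].
  (* At the midpoint [v]: by [u] the outer ends of [j] and [l] are not at [v], and interior points
     of edges are not vertices. *)
  - rewrite sh m2 => vE; apply: esym; apply: contrapT => th.
    have [t0|[t1|tt]] : t = 0 \/ (t = 1 \/ (0 < t < 1)).
      by move: t01; rewrite !le_eqVlt => /andP[/orP[/eqP|] ? /orP[/eqP|] ?]; auto; right; right; apply/andP.
    + have : phi j (flip (~~ b) 0) = v.
        rewrite vE t0 mL ?mulr0 ?subr0; last lra.
        by case: (b); rewrite /= ?subrr ?subr0.
      by move/u => -[[]|[/eqP]]; [case: (b)|rewrite (negPf jl)].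
    + have : phi l (flip (~~ b') 0) = v.
        rewrite vE t1 mR; last lra.
        have -> : 2 * 1 - 1 = 1 :> R by lra.
        by case: (b'); rewrite /= ?subrr ?subr0.
      by move/u => -[[/esym/eqP]|[]]; [rewrite (negPf jl)|case: (b')].
    + case: (leP t (1 / 2)) => th'; move: vE.
        rewrite mL // => vE; apply: (@edge_nvertex _ _ _ _ dec j (flip b (1 - 2 * t))).
          by apply: flip01; move/eqP: th; lra.
        by rewrite -vE.
      rewrite mR ?ltW // => vE; apply: (@edge_nvertex _ _ _ _ dec l (flip b' (2 * t - 1))).
        by apply: flip01; lra.
      by rewrite -vE.
pose psi (i : {i : I | i != l}) t := if val i == j then m t else phi (val i) t.
have jS : {i : {i : I | i != l} | val i = j} by exists (exist _ j jl).
exists psi; split.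
- by move=> i; rewrite /psi; case: (val i == j); [exact: mc|exact: phic].
- move=> x; have [i [t [t01 ->]]] := cover x.
  have [jj jjE] := jS.
  have psij r : psi jj r = m r by rewrite /psi jjE eqxx.
  case: (eqVneq i j) => [->|ij].
    pose r := (1 - flip b t) / 2.
    have := fl01 b t t01 => ft; exists jj, r; rewrite psij; split; first by rewrite /r; lra.
    rewrite mL; last by rewrite /r; lra.
    by have -> : 1 - 2 * r = flip b t by [rewrite /r; lra]; rewrite flipK.
  case: (eqVneq i l) => [->|il].
    pose r := (1 + flip b' t) / 2.
    have := fl01 b' t t01 => ft; exists jj, r; rewrite psij; split; first by rewrite /r; lra.
    rewrite mR; last by rewrite /r; lra.
    by have -> : 2 * r - 1 = flip b' t by [rewrite /r; lra]; rewrite flipK.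
  by exists (exist _ i il), t; rewrite /psi /= (negPf ij).
- move=> i i' s t s01 t01; rewrite /psi; case: (eqVneq (val i) j) => ij; case: (eqVneq (val i') j) => i'j.
  + by move/injm => ->//; split=> //; apply: val_inj; rewrite ij i'j.
  (* A common point of the new edge's interior and another edge would be a vertex, hence [v], but
     [u] lets no third edge end at [v]. *)
  + move=> mE; exfalso; have i'l : val i' != l := valP i'.
    have [t01'|nt] := pselect (0 < t < 1).
      have [k [q [kjl q01 qE]]] := mcov s (oc s01).
      move: mE; rewrite qE => /esym /disj[] // ik _.
      by case: kjl => kE; [move/eqP: i'j|move/eqP: i'l]; apply; rewrite ik.
    have vt : vertex (phi (val i') t).
      exists (val i'); move: t01 nt; rewrite !le_eqVlt => /andP[/orP[/eqP <-|t0] /orP[/eqP t1|t1]]; rewrite ?t1; auto.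
      by case; apply/andP.
    have sh : s = 1 / 2.
      case: (ltgtP s (1 / 2)) => // sh; exfalso; move: vt; rewrite -mE.
        by rewrite mL ?ltW //; apply: (edge_nvertex dec); apply: flip01; lra.
      by rewrite mR ?ltW //; apply: (edge_nvertex dec); apply: flip01; lra.
    move: mE; rewrite sh m2 => vE.
    have [d dE] : exists d, t = flip d 0.
      move: t01 nt; rewrite !le_eqVlt => /andP[/orP[/eqP <-|t0] /orP[/eqP t1|t1]] nt.
      * by exists false.
      * by exists false.
      * by exists true; rewrite /= subr0.
      * by case: nt; apply/andP.
    move: vE; rewrite dE => /esym /u [[iE _]|[iE _]]; first by move/eqP: i'j; apply.
    by move/eqP: i'l; apply.
  + move=> mE; exfalso; have il : val i != l := valP i.
    have [k [q [kjl q01 qE]]] := mcov t t01.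
    move: mE; rewrite qE => /disj[] // ik _.
    by case: kjl => kE; [move/eqP: ij|move/eqP: il]; apply; rewrite ik.
  + by move=> /disj[] // /val_inj -> ->.
Qed.

End Ends.

(** The circle cut at one point, retaining only that some homeomorphism moves this point. *)
Definition circle_like (R : realType) (X : topologicalType) (I : finType) (phi : I -> R -> X) :=
  exists j, [/\ forall i, i = j, phi j 0 = phi j 1
    & exists2 h, is_homeo X h & ~ vertex phi (h (phi j 0))].

(** Induction on the number of edges. A homeomorphism taking a point inside an edge to a vertex
    yields a chart there, hence exactly two ends. If they belong to different edges, merging lowers
    the number of edges; if to the same edge, that loop is all of [X]. *)
Lemma reduced_decomposition (R : realType) (X : topologicalType) (I : finType)
    (phi : I -> R -> X) :
  hausdorff_space X -> connected [set: X] -> edge_decomposition phi ->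
  exists (J : finType) (psi : J -> R -> X), edge_decomposition psi /\
    ((forall h, is_homeo X h -> forall x, vertex psi (h x) <-> vertex psi x) \/
     circle_like psi).
Proof.
move=> Xh Xco; have [n] := ubnP #|I|; elim: n I phi => // n IH I phi; rewrite ltnS => In dec.
have [inv|ninv] := pselect (forall h, is_homeo X h -> forall x, vertex phi (h x) -> vertex phi x).
  exists I, phi; split=> //; left=> h hh x; split; first exact: inv.
  have [hc [h' [h'c [hK h'K]]]] := hh.
  by move=> vx; apply: (inv h'); [split=> //; exists h|rewrite hK].
have [h' [x [hh' [vx nvx]]]] : exists h x, is_homeo X h /\ (vertex phi (h x) /\ ~ vertex phi x).
  apply: contrapT => H; apply: ninv => h hh x vx; apply: contrapT => nvx.
  by apply: H; exists h, x.
have [h'c [h [hc [h'K hK]]]] := hh'.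
have [i [t0 [_ t01 xE]]] := (vertexPn dec x).1 nvx.
have ch : chart (h' \o phi i) t0 by exact: (chart_homeo Xh dec i hc h'c hK h'K t01).
have cv : vertex phi ((h' \o phi i) t0) by rewrite /= -xE.
have [[j b] [[l b'] [pq Ej El u]]] := two_ends Xh dec ch cv.
have [jl|jl] := eqVneq j l.
  have bb : b' = ~~ b by move: pq; rewrite jl /eq_op /= eqxx /=; case: b b' {Ej El u} => -[].
  have all_j : forall k, k = j.
    apply: (@loop_edge _ _ Xh _ _ dec j b ((h' \o phi i) t0)) => //.
      by rewrite -bb jl.
    by move=> k d /u[] [-> _].
  have [E0 E1] : phi j 0 = h' x /\ phi j 1 = h' x.
    by move: Ej El; rewrite -jl bb /= -xE; case: (b) => /=; rewrite subr0 => -> ->.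
  exists I, phi; split=> //; right; exists j; split=> //; first by rewrite E0.
  by exists h; [split=> //; exists h'|rewrite E0 h'K].
have [psi dpsi] := merge_edges dec jl cv Ej El u.
apply: (IH _ psi) => //; rewrite card_sig.
apply: leq_trans In; rewrite -(cardC (pred1 l)) /= card1 add1n ltnS.
by apply: subset_leq_card; apply/fintype.subsetP => k; rewrite !inE.
Qed.

(** * Heights *)

Section Heights.
Variables (X : topologicalType) (G : set (X -> X)).

Lemma height_is_max h : has_chain G h -> (forall n, has_chain G n -> (n <= h)%N) ->
  height_is G (Fin h).
Proof. by move=> ch le; split=> [n /le //|u]; exact. Qed.

Lemma height_is_unbounded : (forall n, has_chain G n) -> height_is G Inf.
Proof.
move=> ch; split=> // -[m /(_ m.+1 (ch _))|//].
by rewrite /= ltnn.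
Qed.

Lemma height_ge h v : has_chain G h -> height_is G v ->
  v = Inf \/ exists k, v = Fin (h + k)%N.
Proof.
move=> ch [le _]; case: v le => [n le|]; [right|by left].
by exists (n - h)%N; rewrite subnKC //; exact: (le h ch).
Qed.

Lemma max_chain N : has_chain G 0 -> (forall n, has_chain G n -> (n <= N)%N) ->
  exists2 h, has_chain G h & forall n, has_chain G n -> (n <= h)%N.
Proof.
move=> h0 le; have ex : exists n, `[<has_chain G n>] by exists 0%N; apply/asboolP.
have ub n : `[<has_chain G n>] -> (n <= N)%N by move/asboolP/le.
have [h /asboolP ch hmax] := ex_maxnP ex ub.
by exists h => // n /asboolP/hmax.
Qed.

End Heights.

Lemma Homeo_group (X : topologicalType) : subgroup_Homeo (Homeo X).
Proof.
split=> //; split; first exact: is_homeo_id.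
split; first by move=> f g; exact: is_homeo_comp.
by move=> f [fc [g [gc [fg gf]]]]; exists g; split=> //; split=> //; exists f.
Qed.

Lemma trivial_group (X : topologicalType) : subgroup_Homeo ([set id] : set (X -> X)).
Proof.
split; first by move=> _ ->; exact: is_homeo_id.
by split=> //; split=> [f g -> ->|_ ->] //; exists id.
Qed.

(** * Heights attained on a space with an edge decomposition *)

Section Graph.
Variables (R : realType) (X : topologicalType).
Hypothesis Xh : hausdorff_space X.
Variables (I : finType) (phi : I -> R -> X).
Hypothesis dec : edge_decomposition phi.
Variable i0 : I.

Local Notation B := (vertex_stab phi).

Let disj i j (s t : R) : 0 < s < 1 -> 0 <= t <= 1 -> phi i s = phi j t -> i = j /\ s = t.
Proof. by case: dec => _ _; apply. Qed.
Let oc (t : R) : 0 < t < 1 -> 0 <= t <= 1.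
Proof. by move=> /andP[a b]; rewrite !ltW. Qed.

Lemma has_chain0 (G : set (X -> X)) : has_chain G 0.
Proof.
exists (fun=> setT); split=> // i _; split; first exact: closedT.
by split=> //; exists (phi i0 0).
Qed.

(** Every nonempty closed set is invariant, so growing finite sets of points on one edge give chains
    of any length. *)
Lemma trivial_height : height_is ([set id] : set (X -> X)) Inf.
Proof.
apply: height_is_unbounded => n.
pose x j := phi i0 (j.+2%:R^-1).
have x01 j : 0 < (j.+2%:R^-1 : R) < 1.
  by rewrite invr_gt0 ltr0n /= invf_lt1 ?ltr0n // ltr1n.
have xi i j : x i = x j -> i = j.
  by move=> /(disj (x01 i) (oc (x01 j)))[_ /invr_inj/eqP]; rewrite eqr_nat => /eqP[].
exists (fun i => if (i < n)%N then x @` [set j | (j <= i)%N] else setT).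
split; last split; last by rewrite ltnn.
  move=> i _; case: ifP => _; split.
  - have /accessible_finite_set_closed : accessible_space X by exact: hausdorff_accessible.
    apply; have -> : [set j | (j <= i)%N] = `I_i.+1 by apply/seteqP; split=> j.
    exact/finite_image/finite_II.
  - by split; [exists (x 0%N), 0%N|move=> _ y ->].
  - exact: closedT.
  - by split; [exists (x 0%N)|move=> _ y ->].
move=> i i_n; rewrite i_n; split; first by case: ifP => // _ _ [j /= ji <-]; exists j => //=; exact: leqW.
move=> /(_ (x i.+1))[|j /= ji /xi ij]; last by rewrite ij ltnn in ji.
by case: ifP => // _; exists i.+1 => /=.
Qed.

Lemma edge_trans i s t : 0 < s < 1 -> 0 < t < 1 -> exists2 h, B h & h (phi i s) = phi i t.
Proof.
have Oi := edge_orbit_id phi i.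
by move=> s01 t01; apply: (edge_orbit_trans Xh dec (i0 := i)); [exists i, s|exists i, t].
Qed.

(** There are finitely many orbits: a colour [(i, Some b)] names one vertex, and [(i, None)] an open
    edge, which lies in a single orbit. *)
Lemma vertex_stab_bounded : exists N, forall n, has_chain B n -> (n <= N)%N.
Proof.
have /choice[c cP] : forall x, exists c : I * option bool,
    if c.2 is Some b then x = phi c.1 (flip b 0) else exists2 t, 0 < t < 1 & x = phi c.1 t.
  move=> x; have [[i vi]|] := pselect (vertex phi x); last first.
    by move=> /(vertexPn dec)[i [t [_ t01 xE]]]; exists (i, None), t.
  case: vi => ->; first by exists (i, Some false).
  by exists (i, Some true); rewrite /= subr0.
exists #|{: I * option bool}| => n /(@chain_bound _ _ _ c) H; apply/ltnW/H => x y cxy.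
have := cP x; have := cP y; rewrite -cxy; case: (c x) => i [b|] /=.
  by move=> -> ->; exists id => //; exact: vertex_stab_id.
by move=> [t t01 ->] [s s01 ->]; exact: edge_trans.
Qed.

Lemma vertex_stab_height : exists h,
  [/\ has_chain B h, forall n, has_chain B n -> (n <= h)%N
    & forall k, exists2 G : set (X -> X), subgroup_Homeo G & height_is G (Fin (h + k)%N)].
Proof.
have [N BN] := vertex_stab_bounded.
have [h Bh hmax] := max_chain (has_chain0 B) BN.
exists h; split=> // k; have [L Lk] := @exists_edge_levels R k.
exists (level_group phi i0 L); first exact: level_group_group.
apply: height_is_max; first exact: level_group_chain_ge.
by move=> n /(level_group_chain_le Xh dec Lk)[m /hmax mh nm]; apply: leq_trans nm _; rewrite leq_add2r.
Qed.

(** The stabilizer has two orbits, the vertex and the open edge. The homeomorphism that moves the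
    vertex joins them into one orbit of [Homeo X]. *)
Lemma circle_like_heights : circle_like phi ->
  [/\ has_chain B 1, forall n, has_chain B n -> (n <= 1)%N
    & forall n, has_chain (Homeo X) n -> (n <= 0)%N].
Proof.
move=> [j [allj E01 [h hh nv]]].
have vj x : vertex phi x <-> x = phi j 0.
  split=> [[i]|->]; last by exists j; left.
  by rewrite (allj i) -E01 => -[].
have edge x y : ~ vertex phi x -> ~ vertex phi y -> exists2 g, B g & g x = y.
  move=> /(vertexPn dec)[i [s [_ s01 ->]]] /(vertexPn dec)[i' [t [_ t01 ->]]].
  by rewrite (allj i) (allj i'); exact: edge_trans.
have half : 0 < (1 / 2 : R) < 1 by apply/andP; split; lra.
split.
- exists (fun i => if i is 0%N then [set phi j 0] else setT); split; last split=> //.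
    move=> [|i] _; split; try split; try exact: closedT.
    + by apply: accessible_closed_set1; exact: hausdorff_accessible.
    + by exists (phi j 0).
    + by move=> g _ [_ gv] ->; apply/vj/gv/vj.
    + by exists (phi j 0).
    + by [].
  move=> [|//] _; split=> // sub; have /vj := sub (phi j (1 / 2)) Logic.I.
  exact: edge_nvertex.
- move=> n /(@chain_bound _ _ _ (fun x => `[<vertex phi x>])); rewrite card_bool ltnS; apply.
  move=> x y; case: (pselect (vertex phi x)) => vx; last first.
    by rewrite (asboolF vx) => /esym/asboolPn; exact: edge.
  rewrite (asboolT vx) => /esym/asboolP/vj ->; exists id; first exact: vertex_stab_id.
  exact/vj.
- have [hc [h' [h'c [hK h'K]]]] := hh.
  have to x : exists2 g, is_homeo X g & g (phi j 0) = x.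
    have [/vj ->|nx] := pselect (vertex phi x); first by exists id => //; exact: is_homeo_id.
    have [g [hg _] gE] := edge _ _ nv nx.
    by exists (g \o h) => //; exact: is_homeo_comp.
  move=> n /(@chain_bound _ _ _ (fun=> tt)); rewrite card_unit ltnS; apply=> x y _.
  have [f [fc [f' [f'c [fK f'K]]]] fx] := to x; have [g hg gy] := to y.
  exists (g \o f'); last by rewrite /= -fx fK.
  by apply: is_homeo_comp => //; split=> //; exists f.
Qed.

Lemma attained_heights : (forall h, is_homeo X h -> forall x, vertex phi (h x) <-> vertex phi x) \/
    circle_like phi ->
  exists h0, [/\ has_chain (Homeo X) h0, forall n, has_chain (Homeo X) n -> (n <= h0)%N
    & forall k, exists2 G : set (X -> X), subgroup_Homeo G & height_is G (Fin (h0 + k)%N)].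
Proof.
have [h [Bh hmax hk]] := vertex_stab_height => -[inv|circ].
  have BE : Homeo X = B by apply/seteqP; split=> [f hf|f []] //; split=> //; exact: inv.
  by exists h; rewrite BE.
have [B1 Ble Hle] := circle_like_heights circ.
have h1 : h = 1%N by apply/eqP; rewrite eqn_leq Ble //= hmax.
exists 0%N; split=> //; first exact: has_chain0.
(* Height 0 is that of [Homeo X] itself; height [k.+1] is [1 + k], obtained from the stabilizer of
   the vertex. *)
case=> [|k]; last by have := hk k; rewrite h1.
exists (Homeo X); first exact: Homeo_group.
by apply: height_is_max Hle; exact: has_chain0.
Qed.

End Graph.

(** By injectivity an interior point of an arc is not one of its end points, so it lies on no other
    arc. *)
Lemma arcs_edge_decomposition (R : realType) (X : pseudoMetricType R) :
  topological_graph X ->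
  exists (n : nat) (phi : 'I_n -> R -> X), edge_decomposition phi.
Proof.
move=> [_ [_ [_ [n [A [a [b [_ [arcs [cov inter]]]]]]]]]].
have /choice[f fP] : forall i : 'I_n, exists f : R -> X,
   [/\ {within `[0%R, 1%R]%classic, continuous f}, f @` `[0, 1]%classic = A i,
     forall s t : R, 0 <= s <= 1 -> 0 <= t <= 1 -> f s = f t -> s = t
   & f 0 = a i /\ f 1 = b i].
  move=> i; have [f [g [fc [fA [_ [_ [fK [_ [f0 f1]]]]]]]]] := arcs i (ltn_ord i).
  exists f; split=> // s t s01 t01 E.
  by rewrite -[s]fK ?E ?fK //= in_itv.
(* The retraction of the line onto [0, 1] extends the parametrisations, which are continuous only
   within [0, 1], to the whole line. *)
pose clamp (t : R) := Num.min 1 (Num.max 0 t).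
have clamp01 t : 0 <= clamp t <= 1 by rewrite /clamp le_min ge_min le_max !lexx ler01.
have clampE t : 0 <= t <= 1 -> clamp t = t.
  by rewrite /clamp => /andP[t0 t1]; rewrite max_r // min_r.
have clampc : continuous clamp.
  have -> : clamp = (fun=> 1) \min ((fun=> 0) \max id) by [].
  move=> t; apply: (@continuous_min R R); first exact: cvg_cst.
  by apply: (@continuous_max R R); [exact: cvg_cst|exact: cvg_id].
exists n, (fun i => f i \o clamp); split.
- move=> i; have [fc _ _ _] := fP i; apply/continuous_closedP => C cC.
  have [V cV VE] : exists2 V, closed (V : set R) & V `&` `[0, 1] = (f i @^-1` C) `&` `[0, 1].
    by apply/closed_subspaceP; move/continuous_closedP: fc; exact.
  have -> : (f i \o clamp) @^-1` C = clamp @^-1` (V `&` `[0, 1]).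
    rewrite VE; apply/seteqP; split=> t /=; last by case.
    by move=> Ct; split=> //; rewrite in_itv /=; exact: clamp01.
  move/continuous_closedP: clampc; apply; apply: closedI => //; exact: itv_closed.
- move=> x; have [i i_n] : (\bigcup_(i in [set i | (i < n)%N]) A i) x by rewrite cov.
  have [_ fA _ _] := fP (Ordinal i_n); rewrite -[A i]fA => -[t].
  rewrite /= in_itv /= => t01 <-; exists (Ordinal i_n), t; split=> //=.
  by rewrite clampE.
- move=> i j s t s01 t01 /=; have s01' : 0 <= s <= 1 by lra.
  rewrite !clampE //; have [_ fAi fi [fi0 fi1]] := fP i; have [_ fAj _ _] := fP j.
  have [<- /fi -> //|ij E] := eqVneq i j.
  have [||[] sE _] := inter i j (ltn_ord i) (ltn_ord j) _ (f i s).
  + by move=> /val_inj/eqP; apply/negP.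
  + split; first by rewrite -fAi; exists s; rewrite //= in_itv.
    by rewrite E -fAj; exists t; rewrite //= in_itv.
  + by move: sE; rewrite /= -fi0 => /fi; lra.
  + by move: sE; rewrite /= -fi1 => /fi; lra.
Qed.

Theorem theorem5p9 (R : realType) (X : pseudoMetricType R) :
  topological_graph X ->
  exists h0 : nat,
    height_is (Homeo X) (Fin h0) /\
    P_h X = [set v | v = Inf \/ exists k : nat, v = Fin (h0 + k)%N].
Proof.
move=> gX; have [Xh [_ [Xco [m [A [a [b [m0 [arcs _]]]]]]]]] := gX.
have [n [phi dec]] := arcs_edge_decomposition gX.
have [I [psi [dpsi alt]]] := reduced_decomposition Xh Xco dec.
(* An end point of an arc serves as a point of [X]; the edge covering it shows that there is an
   edge. *)
have [i0 _] := (let: And3 _ c _ := dpsi in c) (a 0%N).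
have [h0 [ch0 le0 all]] := attained_heights Xh dpsi i0 alt.
exists h0; split; first exact: height_is_max.
apply/seteqP; split=> [v [G [Gg Gv]]|v [->|[k ->]]].
- by apply: height_ge Gv; apply: has_chain_sub ch0; case: Gg.
- exists [set id]; split; first exact: trivial_group.
  exact: trivial_height dpsi i0.
- by have [G ? ?] := all k; exists G.
Qed.
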